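(* Let $(X,\mathcal{A},\mu)$ be a charge space, and let $\mathcal{M} := \{A\in\mathcal{A}:\mu(A)=0\}$. Suppose $\phi: \mathcal{A} /\mathcal{M} \rightarrow \mathcal{P}(Y)$ is a representation of the Boolean algebra $\mathcal{A} /\mathcal{M}$, where $Y$ is a set. For $A\in\mathcal{A}$ write $\langle A\rangle_\phi:=\phi([A])$, and write $\langle\mathcal{A}\rangle_\phi:=\{\langle A\rangle_\phi:A\in\mathcal{A}\}$. Then the following statements hold. 1. $L_1(X,\mathcal{A},\mu)$ is complete if and only if $(Y,\overline{\langle \mathcal{A} \rangle_{\phi}}, \overline{\mu})$ is a measure space, where $(Y,\overline{\langle \mathcal{A} \rangle_{\phi}}, \overline{\mu})$ is the Peano-Jordan completion of the charge space $(Y,\langle\mathcal{A}\rangle_\phi,\mu)$ and $\mu : \langle \mathcal{A} \rangle_{\phi} \rightarrow [0,\infty)$ is the charge defined by $\mu(\langle A \rangle_{\phi}) := \mu(A)$ for all $A \in \mathcal{A}$. 2. If $\mathcal{A} / \mathcal{M}$ is a countably complete Boolean algebra and the function $\mu : \mathcal{A} / \mathcal{M} \rightarrow [0,\infty)$, defined by $\mu([ A ]) := \mu(A)$ for all $A \in \mathcal{A}$, is a countably additive function, then $L_1(X,\mathcal{A},\mu)$ is complete.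
   Context: A field $\mathcal{A}$ of subsets of a set $X$ is a collection containing $\emptyset$ and closed under complements and finite unions. A charge $\mu$ on $\mathcal{A}$ is a function $\mu:\mathcal{A}\to[0,\infty)$ with $\mu(\emptyset)=0$ and $\mu(A\cup B)=\mu(A)+\mu(B)$ for disjoint $A,B\in\mathcal{A}$ (all charges are non-negative and bounded). Then $(X,\mathcal{A},\mu)$ is a charge space. Outer charge: $\mu^*(A):=\inf\{\mu(B): B\in\mathcal{A}, A\subseteq B\}$. $f_n\to f$ hazily if for every $\epsilon>0$, $\mu^*(\{x:|f_n(x)-f(x)|>\epsilon\})\to 0$. A simple function is $\sum_{k=1}^K c_kI_{A_k}$ with $\{A_1,\dots,A_K\}\subset\mathcal{A}$ a finite partition of $X$; its integral is $\sum_k c_k\mu(A_k)$. $f:X\to\mathbb{R}$ is integrable if there are simple functions $f_n\to f$ hazily with $\int|f_n-f_m|d\mu\to0$ as $n,m\to\infty$, and then $\int f d\mu:=\lim_n\int f_n d\mu$ (well defined). $L_1(X,\mathcal{A},\mu)$ is the vector space of integrable functions with pseudonorm $\|f\|_1=\int|f|d\mu$; complete means every Cauchy sequence in this pseudonorm converges. $\mathcal{A}$ is a Boolean algebra under set operations and $\mathcal{M}$ is an ideal of it; $[A]\in\mathcal{A}/\mathcal{M}$ is the class of $A$ under $A\sim B\iff A\triangle B\in\mathcal{M}$. A representation of a Boolean algebra $\mathcal{B}$ is an injective Boolean algebra homomorphism $\phi:\mathcal{B}\to\mathcal{P}(Y)$ into the power set of some set $Y$ (a Boolean isomorphism onto a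 field of subsets of $Y$). Peano-Jordan completion of a charge space $(Y,\mathcal{B},\mu)$: $\overline{\mathcal{B}}:=\{A\subseteq Y:\forall\epsilon>0\ \exists B,C\in\mathcal{B}, B\subseteq A\subseteq C, \mu(C\setminus B)<\epsilon\}$ and $\overline{\mu}(A):=\inf\{\mu(C):A\subseteq C\in\mathcal{B}\}=\sup\{\mu(B):\mathcal{B}\ni B\subseteq A\}$. It is a measure space if $\overline{\mathcal{B}}$ is a $\sigma$-field and $\overline{\mu}$ is countably additive. A Boolean algebra is countably complete if every countable subset has a least upper bound. A countably additive function on a countably complete Boolean algebra $\mathcal{B}$ is $\mu:\mathcal{B}\to[0,\infty)$ with $\mu(0)=0$ and $\mu(\bigvee_{k}p_k)=\sum_{k}\mu(p_k)$ for every pairwise disjoint sequence $\{p_k\}_{k=1}^\infty$ in $\mathcal{B}$. *)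

(* Defs.v *)
From HB Require Import structures.
From mathcomp Require Import all_boot all_order all_algebra generic_quotient.
From mathcomp Require Import all_classical all_reals all_analysis.

Set Implicit Arguments.
Unset Strict Implicit.
Unset Printing Implicit Defensive.

Import Order.TTheory GRing.Theory Num.Theory.
Import numFieldNormedType.Exports.

Local Open Scope classical_set_scope.
Local Open Scope quotient_scope.
Local Open Scope ring_scope.

(* The charge is a function on all of [set X]; only its values on the field
   [cs_field] are meaningful, and only those are used below. *)
Record charge_space (R : realType) (X : Type) := ChargeSpace {
  cs_field : set (set X);
  cs_charge : set X -> R;
  cs_field0 : cs_field set0;
  cs_fieldC : setC_closed cs_field;
  cs_fieldU : setU_closed cs_field;
  cs_charge_ge0 : forall A, cs_field A -> 0 <= cs_charge A;
  cs_charge0 : cs_charge set0 = 0;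
  cs_chargeU : forall A B, cs_field A -> cs_field B -> A `&` B = set0 ->
    cs_charge (A `|` B) = cs_charge A + cs_charge B }.

Section field_theory.
Context {R : realType} {X : Type} (C : charge_space R X).
Implicit Types A B D : set X.

Lemma cs_fieldT : cs_field C setT.
Proof. by rewrite -setC0; apply: cs_fieldC; exact: cs_field0. Qed.

Lemma cs_fieldI A B : cs_field C A -> cs_field C B -> cs_field C (A `&` B).
Proof.
move=> fA fB; rewrite -[_ `&` _]setCK setCI.
by apply: cs_fieldC; apply: cs_fieldU; apply: cs_fieldC.
Qed.

Lemma cs_fieldD A B : cs_field C A -> cs_field C B -> cs_field C (A `\` B).
Proof. by move=> fA fB; rewrite setDE; apply: cs_fieldI (cs_fieldC _). Qed.

Lemma cs_fieldY A B : cs_field C A -> cs_field C B -> cs_field C (A `+` B).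
Proof.
by move=> fA fB; rewrite /setY; apply: cs_fieldU; apply: cs_fieldD.
Qed.

Lemma cs_chargeID A B : cs_field C A -> cs_field C B ->
  cs_charge C A = cs_charge C (A `&` B) + cs_charge C (A `\` B).
Proof.
move=> fA fB; rewrite -cs_chargeU ?setUIDK //; first exact: cs_fieldI.
  exact: cs_fieldD.
by rewrite -subset0 => x [[_ ?] [_]].
Qed.

Lemma cs_charge_le A B : cs_field C A -> cs_field C B -> A `<=` B ->
  cs_charge C A <= cs_charge C B.
Proof.
move=> fA fB AB; rewrite (cs_chargeID fB fA) (setIidr AB) lerDl.
by apply: cs_charge_ge0; apply: cs_fieldD.
Qed.

Definition null_ideal : set (set X) :=
  [set A | cs_field C A /\ cs_charge C A = 0].

Lemma null_ideal_sub A B : cs_field C A -> null_ideal B -> A `<=` B ->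
  null_ideal A.
Proof.
move=> fA [fB B0] AB; split => //; apply/eqP; rewrite eq_le.
by rewrite cs_charge_ge0 // -B0 cs_charge_le.
Qed.

Lemma null_idealU A B : null_ideal A -> null_ideal B -> null_ideal (A `|` B).
Proof.
move=> [fA A0] [fB B0]; split; first exact: cs_fieldU.
rewrite (@cs_chargeID _ A) //; last exact: cs_fieldU.
rewrite setUK A0 add0r.
have [] // : null_ideal ((A `|` B) `\` A).
apply: (@null_ideal_sub _ B) => //; first exact/cs_fieldD/fA/cs_fieldU.
by move=> x [[]].
Qed.

End field_theory.

Section integration.
Context {R : realType} {X : Type} (C : charge_space R X).
Implicit Types (f : X -> R) (A B : set X).

Definition outer_charge A : R :=
  inf [set cs_charge C B | B in [set B | cs_field C B /\ A `<=` B]].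

Definition hazy_cvg (fn : nat -> X -> R) f : Prop :=
  forall e : R, 0 < e ->
    outer_charge [set x | e < `|fn n x - f x|] @[n --> \oo] --> 0.

Definition simple_with_integral f (I : R) : Prop :=
  exists (K : nat) (c : 'I_K -> R) (A : 'I_K -> set X),
    [/\ forall k, cs_field C (A k),
        partition [set: 'I_K] A [set: X],
        forall x, f x = \sum_(k < K) c k * \1_(A k) x
      & I = \sum_(k < K) c k * cs_charge C (A k)].

Definition simple_fun f : Prop := exists I, simple_with_integral f I.

(* [xget] picks the value of the sum, which is the same for all the
   representations of [f]. *)
Definition simple_integral f : R := xget 0 [set I | simple_with_integral f I].

Definition determining (fn : nat -> X -> R) f : Prop :=
  [/\ forall n, simple_fun (fn n),
      hazy_cvg fn f
    & simple_integral (fun x => `|fn p.1 x - fn p.2 x|)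
        @[p --> filter_prod \oo \oo] --> 0].

Definition charge_integrable f : Prop := exists fn, determining fn f.

(* The limit picked by [xget] does not depend on the determining sequence. *)
Definition charge_integral f : R :=
  xget 0 [set I | exists2 fn, determining fn f &
                    simple_integral (fn n) @[n --> \oo] --> I].

Definition L1 : set (X -> R) := [set f | charge_integrable f].

Definition L1norm f : R := charge_integral (fun x => `|f x|).

Definition L1_complete : Prop :=
  forall f : nat -> X -> R, (forall n, L1 (f n)) ->
    L1norm (fun x => f p.1 x - f p.2 x) @[p --> filter_prod \oo \oo] --> 0 ->
    exists2 g, L1 g & L1norm (fun x => f n x - g x) @[n --> \oo] --> 0.

End integration.

Section peano_jordan.
Context {R : realType} {Y : Type} (C : charge_space R Y).

Definition pj_field : set (set Y) :=
  [set A | forall e : R, 0 < e -> exists B D, [/\ cs_field C B, cs_field C D,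
     B `<=` A, A `<=` D & cs_charge C (D `\` B) < e]].

Definition pj_charge (A : set Y) : R :=
  inf [set cs_charge C D | D in [set D | cs_field C D /\ A `<=` D]].

Lemma pj_charge_sup (A : set Y) : pj_field A ->
  pj_charge A = sup [set cs_charge C B | B in [set B | cs_field C B /\ B `<=` A]].
Proof.
move=> pjA; rewrite /pj_charge; set U := (X in inf X); set L := (X in sup X).
have LU x y : L x -> U y -> x <= y.
  move=> [B [fB BA] <-] [D [fD AD] <-].
  by apply: cs_charge_le => //; exact: subset_trans BA AD.
have Un0 : U !=set0.
  by exists (cs_charge C setT); exists setT => //; split; first exact: cs_fieldT.
have Ln0 : L !=set0.
  by exists (cs_charge C set0); exists set0 => //; split; first exact: cs_field0.
have [[u Uu] [l Ll]] := (Un0, Ln0).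
have supL : has_sup L by split => //; exists u => x /LU; exact.
have infU : has_inf U by split => //; exists l => x; exact: LU.
apply/eqP; rewrite eq_le; apply/andP; split; last first.
  apply: lb_le_inf => // y Uy; apply: sup_le_ub => // x Lx; exact: LU.
apply/ler_addgt0Pr => e /pjA[B [D [fB fD BA AD DBe]]].
apply: (@le_trans _ _ (cs_charge C D)).
  by apply: ge_inf; [exact: infU.2|exists D].
rewrite (cs_chargeID fD fB) setIidr; last exact: subset_trans BA AD.
by rewrite lerD //; [apply: ub_le_sup; [exact: supL.2|exists B]|exact: ltW].
Qed.

End peano_jordan.

Definition is_measure_space (R : realType) (Y : Type) (S : set (set Y))
    (m : set Y -> R) : Prop :=
  sigma_algebra [set: Y] S /\
  forall F : nat -> set Y, (forall k, S (F k)) -> trivIset [set: nat] F ->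
    series (m \o F) @ \oo --> m (\bigcup_k F k).

Record representation d (B : ctbDistrLatticeType d) (Y : Type) :=
  Representation {
  rep_fun :> B -> set Y;
  rep_inj : injective rep_fun;
  rep0 : rep_fun \bot%O = set0;
  rep1 : rep_fun \top%O = [set: Y];
  repI : forall x y, rep_fun (x `&` y)%O = rep_fun x `&` rep_fun y;
  repU : forall x y, rep_fun (x `|` y)%O = rep_fun x `|` rep_fun y;
  repC : forall x, rep_fun (~` x)%O = ~` rep_fun x }.

Definition countably_complete d (B : ctbDistrLatticeType d) : Prop :=
  forall S : set B, countable S -> supremums S !=set0.

Definition countably_additive (R : realType) d (B : ctbDistrLatticeType d)
    (m : B -> R) : Prop :=
  [/\ forall p, 0 <= m p, m \bot%O = 0
    & forall p : nat -> B, (forall i j, i != j -> (p i `&` p j)%O = \bot%O) ->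
        forall s, supremums (range p) s -> series (m \o p) @ \oo --> m s].


Section quotient.
Context {R : realType} {X : Type} (C : charge_space R X).

(* [cs_field C], used as a type, is the subtype of the sets of the field. *)
Implicit Types a b c : cs_field C.

Definition fld_mk (A : set X) (fA : cs_field C A) : cs_field C :=
  exist _ A (mem_set fA).

Lemma fldP a : cs_field C (val a).
Proof. exact: set_mem (valP a). Qed.

Definition fld0 := fld_mk (cs_field0 C).
Definition fldT := fld_mk (cs_fieldT C).
Definition fldI a b := fld_mk (cs_fieldI (fldP a) (fldP b)).
Definition fldU a b := fld_mk (cs_fieldU (fldP a) (fldP b)).
Definition fldC a := fld_mk (cs_fieldC (fldP a)).

Definition null_eq : rel (cs_field C) :=
  fun a b => `[< null_ideal C (val a `+` val b) >].

Lemma null_eq_refl : reflexive null_eq.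
Proof.
by move=> a; apply/asboolP; rewrite setYK; split; [exact: cs_field0|exact: cs_charge0].
Qed.

Lemma null_eq_sym : symmetric null_eq.
Proof. by move=> a b; rewrite /null_eq setYC. Qed.

Lemma null_eq_trans : transitive null_eq.
Proof.
move=> b a c /asboolP ab /asboolP bc; apply/asboolP.
apply: null_ideal_sub (null_idealU ab bc) _.
  by apply: cs_fieldY; exact: fldP.
by move=> x /=; have [] := EM (val b x); tauto.
Qed.

Definition null_equiv := EquivRel null_eq null_eq_refl null_eq_sym null_eq_trans.

Definition null_quot : Type := {eq_quot null_equiv}.

HB.instance Definition _ := Choice.on null_quot.
HB.instance Definition _ := EqQuotient.on null_quot.

Definition fclass a : null_quot := \pi_null_quot a.

Lemma fclassP a b : fclass a = fclass b <-> null_ideal C (val a `+` val b).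
Proof. by split=> [/eqquotP /asboolP|?]; last by apply/eqquotP/asboolP. Qed.

Lemma fclassW (P : null_quot -> Prop) : (forall a, P (fclass a)) -> forall x, P x.
Proof. by move=> h x; rewrite -[x]reprK; exact: h. Qed.

Lemma fclass_repr a : null_ideal C (val (repr (fclass a)) `+` val a).
Proof. by apply/fclassP; rewrite /fclass reprK. Qed.

Definition nqI (x y : null_quot) : null_quot := fclass (fldI (repr x) (repr y)).
Definition nqU (x y : null_quot) : null_quot := fclass (fldU (repr x) (repr y)).
Definition nqC (x : null_quot) : null_quot := fclass (fldC (repr x)).

Lemma fclassI a b : nqI (fclass a) (fclass b) = fclass (fldI a b).
Proof.
apply/fclassP/(null_ideal_sub _ (null_idealU (fclass_repr a) (fclass_repr b))).
  by apply: cs_fieldY; exact: fldP.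
move=> x /=.
move: (sval (repr _) x) (sval (repr _) x) (sval a x) (sval b x) => A' B' A B.
by have [] := EM A; have [] := EM B; have [] := EM A'; have [] := EM B'; tauto.
Qed.

Lemma fclassU a b : nqU (fclass a) (fclass b) = fclass (fldU a b).
Proof.
apply/fclassP/(null_ideal_sub _ (null_idealU (fclass_repr a) (fclass_repr b))).
  by apply: cs_fieldY; exact: fldP.
move=> x /=.
move: (sval (repr _) x) (sval (repr _) x) (sval a x) (sval b x) => A' B' A B.
by have [] := EM A; have [] := EM B; have [] := EM A'; have [] := EM B'; tauto.
Qed.

Lemma fclassC a : nqC (fclass a) = fclass (fldC a).
Proof.
apply/fclassP/(null_ideal_sub _ (fclass_repr a)).
  by apply: cs_fieldY; exact: fldP.
move=> x /=; move: (sval (repr _) x) (sval a x) => A' A.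
by have [] := EM A; have [] := EM A'; tauto.
Qed.

Let nqIC : commutative nqI.
Proof.
by elim/fclassW=> a; elim/fclassW=> b; rewrite !fclassI; congr fclass;
  apply: val_inj; exact: setIC.
Qed.

Let nqUC : commutative nqU.
Proof.
by elim/fclassW=> a; elim/fclassW=> b; rewrite !fclassU; congr fclass;
  apply: val_inj; exact: setUC.
Qed.

Let nqIA : associative nqI.
Proof.
by elim/fclassW=> a; elim/fclassW=> b; elim/fclassW=> c; rewrite !fclassI;
  congr fclass; apply: val_inj; exact: setIA.
Qed.

Let nqUA : associative nqU.
Proof.
by elim/fclassW=> a; elim/fclassW=> b; elim/fclassW=> c; rewrite !fclassU;
  congr fclass; apply: val_inj; exact: setUA.
Qed.

Let nqUK (y x : null_quot) : nqI x (nqU x y) = x.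
Proof.
elim/fclassW: x => a; elim/fclassW: y => b; rewrite fclassU fclassI.
by congr fclass; apply: val_inj; rewrite /= setUC setKU.
Qed.

Let nqIK (y x : null_quot) : nqU x (nqI x y) = x.
Proof.
elim/fclassW: x => a; elim/fclassW: y => b; rewrite fclassI fclassU.
by congr fclass; apply: val_inj; rewrite /= setIC setKI.
Qed.

Let nqIUl : left_distributive nqI nqU.
Proof.
elim/fclassW=> a; elim/fclassW=> b; elim/fclassW=> c.
rewrite !(fclassI, fclassU); congr fclass; apply: val_inj; exact: setIUl.
Qed.

Let nqII : idempotent_op nqI.
Proof.
by elim/fclassW=> a; rewrite fclassI; congr fclass; apply: val_inj; exact: setIid.
Qed.

Fact null_quot_display : Order.disp_t. Proof. exact. Qed.

HB.instance Definition _ :=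
  Order.isMeetJoinDistrLattice.Build null_quot_display null_quot
    (fun _ _ => erefl) (fun _ _ => erefl)
    nqIC nqUC nqIA nqUA nqUK nqIK nqIUl nqII.

Let nq0x (x : null_quot) : (fclass fld0 <= x)%O.
Proof.
elim/fclassW: x => a; rewrite leEmeet; apply/eqP; rewrite [LHS]fclassI.
by congr fclass; apply: val_inj; exact: set0I.
Qed.

Let nqxT (x : null_quot) : (x <= fclass fldT)%O.
Proof.
elim/fclassW: x => a; rewrite leEmeet; apply/eqP; rewrite [LHS]fclassI.
by congr fclass; apply: val_inj; exact: setIT.
Qed.

HB.instance Definition _ := Order.hasBottom.Build null_quot_display null_quot nq0x.
HB.instance Definition _ := Order.hasTop.Build null_quot_display null_quot nqxT.

Let nqUCr (x : null_quot) : (x `|` nqC x)%O = \top%O.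
Proof.
elim/fclassW: x => a; rewrite fclassC [LHS]fclassU.
by congr fclass; apply: val_inj; exact: setUv.
Qed.

Let nqICr (x : null_quot) : (x `&` nqC x)%O = \bot%O.
Proof.
elim/fclassW: x => a; rewrite fclassC [LHS]fclassI.
by congr fclass; apply: val_inj; exact: setICr.
Qed.

HB.instance Definition _ :=
  Order.TBDistrLattice_hasComplement.Build null_quot_display null_quot nqUCr nqICr.

Definition nq_charge (x : null_quot) : R := cs_charge C (val (repr x)).

Lemma null_eq_charge a b : null_ideal C (val a `+` val b) ->
  cs_charge C (val a) = cs_charge C (val b).
Proof.
move=> nab; rewrite (cs_chargeID (fldP a) (fldP b)) (cs_chargeID (fldP b) (fldP a)).
have [_ ->] : null_ideal C (val a `\` val b).
  apply: null_ideal_sub nab _; first by apply: cs_fieldD; exact: fldP.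
  by move=> x; left.
have [_ ->] : null_ideal C (val b `\` val a).
  apply: null_ideal_sub nab _; first by apply: cs_fieldD; exact: fldP.
  by move=> x; right.
by rewrite setIC.
Qed.

Lemma nq_chargeE a : nq_charge (fclass a) = cs_charge C (val a).
Proof. exact/null_eq_charge/fclass_repr. Qed.

End quotient.

Arguments nq_charge {R X} C x.

Section represented.
Context {R : realType} {X Y : Type} (C : charge_space R X).
Variable phi : representation (null_quot C) Y.

Definition rep_set (a : cs_field C) : set Y := phi (fclass a).

Definition rep_field : set (set Y) := range rep_set.

Definition rep_charge (S : set Y) : R :=
  nq_charge C (xget \bot%O [set x | phi x = S]).

Lemma rep_chargeE (a : cs_field C) : rep_charge (rep_set a) = cs_charge C (val a).
Proof.
rewrite /rep_charge; case: xgetP => [x _ /rep_inj ->|/(_ (fclass a) erefl)] //.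
exact: nq_chargeE.
Qed.

Let rep_field0 : rep_field set0.
Proof. by exists (fld0 C) => //; exact: rep0. Qed.

Let rep_fieldC : setC_closed rep_field.
Proof.
by move=> _ [a _ <-]; exists (fldC a) => //; rewrite /rep_set -fclassC; exact: repC.
Qed.

Let rep_fieldU : setU_closed rep_field.
Proof.
move=> _ _ [a _ <-] [b _ <-]; exists (fldU a b) => //.
by rewrite /rep_set -fclassU; exact: repU.
Qed.

Let rep_charge_ge0 S : rep_field S -> 0 <= rep_charge S.
Proof. by move=> [a _ <-]; rewrite rep_chargeE; exact/cs_charge_ge0/fldP. Qed.

Let rep_charge0 : rep_charge set0 = 0.
Proof.
rewrite -(cs_charge0 C) -[set0 in RHS]/(val (fld0 C)) -rep_chargeE.
by congr rep_charge; rewrite -(rep0 phi).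
Qed.

Let rep_chargeU S T : rep_field S -> rep_field T -> S `&` T = set0 ->
  rep_charge (S `|` T) = rep_charge S + rep_charge T.
Proof.
move=> [a _ <-] [b _ <-] ab0.
have [fab nab] : null_ideal C (val a `&` val b).
  have : fclass (fldI a b) = fclass (fld0 C).
    apply: (@rep_inj _ _ _ phi); rewrite -fclassI.
    by rewrite -[RHS]/(phi \bot%O) rep0 -ab0; exact: repI.
  by move/fclassP; rewrite [val (fld0 C)]/= setY0.
have -> : rep_set a `|` rep_set b = rep_set (fldU a b).
  by rewrite /rep_set -fclassU; exact/esym/repU.
rewrite !rep_chargeE /=.
rewrite (cs_chargeID (cs_fieldU (fldP a) (fldP b)) (fldP a)).
rewrite setUK; congr (_ + _).
rewrite (cs_chargeID (fldP b) (fldP a)) [_ `&` _]setIC nab add0r.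
by rewrite setDUl setDv set0U.
Qed.

Definition rep_charge_space : charge_space R Y :=
  ChargeSpace rep_field0 rep_fieldC rep_fieldU rep_charge_ge0 rep_charge0
    rep_chargeU.

End represented.

(* Main.v *)
(** Both sides of the equivalence say that countable unions in the field can be
    covered economically: for [A_n] in the field and [e > 0] there is [D] in the
    field containing every [A_n] up to a null set, with charge at most [e] above
    that of some finite union of the [A_n].

    If [L1] is complete, the indicators of the finite unions converge in [L1] to
    some [g], and [D] is a late finite union together with a small set covering
    the points where its indicator is far from [g]. Conversely, let [t_k] be
    simple functions with [|t_(k+1) - t_k|_1 < 4^-k], and let [D_k] cover, up to
    null sets, all the sets [{|t_(i+1) - t_i| >= 2^-i}] with [i >= k]. Each increment
    is dropped on the null set that the covers [D_0, ..., D_i] miss; the resulting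
    series converges uniformly off each [D_k], which gives a hazy limit.

    The covering property only depends on the quotient by the null ideal, and in
    the represented field null sets are empty, so there it becomes a sandwich of
    countable unions between sets of the field, which amounts to the Peano-Jordan
    completion being a measure space. If the quotient is countably complete and
    its charge countably additive, [D] is a representative of the supremum of the
    classes of the [A_n]. *)

Require Import Defs.
From mathcomp Require Import all_boot all_order all_algebra.
From mathcomp Require Import all_classical all_reals all_analysis.
From mathcomp Require Import lra.

Set Implicit Arguments.
Unset Strict Implicit.
Unset Printing Implicit Defensive.

Import Order.TTheory GRing.Theory Num.Theory.
Import numFieldNormedType.Exports.

Local Open Scope classical_set_scope.
Local Open Scope ring_scope.

(** * Finite unions in the field, and maps to finite types with fibres in the field *)

Section finite_unions.
Context {R : realType} {X : Type} (C : charge_space R X).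
Implicit Types (A B : set X) (T U : finType).

Local Notation mu := (cs_charge C).
Local Notation field := (cs_field C).

Lemma field_bigU I (r : seq I) (P : pred I) (F : I -> set X) :
  (forall i, P i -> field (F i)) -> field (\big[setU/set0]_(i <- r | P i) F i).
Proof.
by move=> fF; elim/big_ind: _ => //; [exact: cs_field0|exact: cs_fieldU].
Qed.

Lemma chargeU_le A B : field A -> field B -> mu (A `|` B) <= mu A + mu B.
Proof.
move=> fA fB; rewrite (cs_chargeID (cs_fieldU fA fB) fA) setUK lerD2l.
rewrite cs_charge_le //; first exact/cs_fieldD/fA/cs_fieldU.
by move=> x [[]].
Qed.

Lemma chargeD A B : field A -> field B -> B `<=` A -> mu (A `\` B) = mu A - mu B.
Proof.
by move=> fA fB BA; rewrite (cs_chargeID fA fB) (setIidr BA) addrAC subrr add0r.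
Qed.

Lemma charge_bigU_le I (r : seq I) (P : pred I) (F : I -> set X) :
  (forall i, P i -> field (F i)) ->
  mu (\big[setU/set0]_(i <- r | P i) F i) <= \sum_(i <- r | P i) mu (F i).
Proof.
move=> fF; elim: r => [|i r IH]; first by rewrite !big_nil cs_charge0.
rewrite !big_cons; case: ifPn => // Pi.
apply: le_trans (chargeU_le (fF i Pi) _) _; first exact: field_bigU.
by rewrite lerD2l.
Qed.

(** Encodes a finite partition of the space by its fibres. Empty fibres are allowed, so a common
    refinement of two partitions is just the pairing of the two maps. *)
Definition field_map T (p : X -> T) := forall t, field (p @^-1` [set t]).

Lemma field_preimage T (p : X -> T) (P : set T) : field_map p -> field (p @^-1` P).
Proof.
move=> fp; have -> : p @^-1` P = \big[setU/set0]_(t in mem P) p @^-1` [set t].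
  rewrite -bigcup_pred; apply/seteqP; split=> [x Px|x [t /= /set_mem Pt ->//]].
  by exists (p x) => //=; exact/mem_set.
exact: field_bigU.
Qed.

Lemma field_map_pair T U (p : X -> T) (q : X -> U) :
  field_map p -> field_map q -> field_map (fun x => (p x, q x)).
Proof.
move=> fp fq [t u].
have -> : (fun x => (p x, q x)) @^-1` [set (t, u)] =
    p @^-1` [set t] `&` q @^-1` [set u].
  by apply/seteqP; split=> x /= [-> ->].
exact: cs_fieldI.
Qed.

Lemma charge_sum_preimage T (p : X -> T) A : field_map p -> field A ->
  mu A = \sum_t mu (A `&` p @^-1` [set t]).
Proof.
move=> fp fA.
have H (s : seq T) : uniq s ->
    mu (A `&` p @^-1` [set` s]) = \sum_(t <- s) mu (A `&` p @^-1` [set t]).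
  elim: s => [_|t s IH /= /andP[ts /IH {}IH]].
    by rewrite big_nil set_nil preimage_set0 setI0 cs_charge0.
  rewrite big_cons -IH -cs_chargeU.
  - rewrite -setIUr -preimage_setU; congr (mu (_ `&` (p @^-1` _))).
    apply/seteqP; split=> y /=; rewrite inE.
      by move=> /orP[/eqP ->|ys]; [left|right].
    by move=> [->|ys]; [rewrite eqxx|rewrite ys orbT].
  - exact/cs_fieldI/field_preimage.
  - exact/cs_fieldI/field_preimage.
  - rewrite -subset0 => x /= [[_ pt] [_ ps]].
    by rewrite -pt ps in ts.
rewrite /index_enum -enumT -H ?enum_uniq //; congr mu; apply/seteqP; split=> [x|x []//].
by split=> //=; rewrite mem_enum.
Qed.

End finite_unions.

(** * Simple functions and their integral *)

Section simple_functions.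
Context {R : realType} {X : Type} (C : charge_space R X).
Implicit Types (A B : set X) (T U : finType) (f g : X -> R).

Local Notation mu := (cs_charge C).
Local Notation field := (cs_field C).
Local Notation field_map := (field_map C).

(** The integral of the simple function [u \o p], computed over all values in [T], attained or
    not. *)
Definition fsum T (p : X -> T) (u : T -> R) : R :=
  \sum_t u t * mu (p @^-1` [set t]).

(** Both sums are refined to the cells where [p] and [q] are constant: an empty cell has charge 0,
    and a point of a nonempty cell compares the two coefficients. Since [p] and [q] may differ, this
    also gives the independence of the integral from the representation. *)
Lemma fsum_le T U (p : X -> T) (q : X -> U) u v : field_map p -> field_map q ->
  (forall x, u (p x) <= v (q x)) -> fsum p u <= fsum q v.
Proof.
move=> fp fq uv; rewrite /fsum.
under eq_bigr do rewrite (charge_sum_preimage fq (fp _)) mulr_sumr.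
under [leRHS]eq_bigr do rewrite (charge_sum_preimage fp (fq _)) mulr_sumr.
rewrite exchange_big /=; apply: ler_sum => w _; apply: ler_sum => t _.
rewrite [X in mu X]setIC; set E := _ `&` _.
have [->|/set0P[x [/= xt xw]]] := eqVneq E set0; first by rewrite cs_charge0 !mulr0.
rewrite ler_wpM2r //; first by apply: cs_charge_ge0; exact: cs_fieldI.
by rewrite -xt -xw.
Qed.

Lemma simple_with_integralP f (I : R) : simple_with_integral C f I <->
  exists T (p : X -> T) u,
    [/\ field_map p, forall x, f x = u (p x) & I = fsum p u].
Proof.
split=> [[K [c [A [fA [cA tA _] fE ->]]]]|[T [p [u [fp fE ->]]]]].
  have pP x : exists k, A k x.
    have : cover setT A x by rewrite cA.
    by case=> k _ Akx; exists k.
  pose p x := sval (cid (pP x)).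
  have Ap x : A (p x) x by rewrite /p; case: cid.
  have pA k : p @^-1` [set k] = A k.
    apply/seteqP; split=> [x <-//|x Akx].
    by apply: (tA (p x) k _ _) => //; exists x.
  exists 'I_K, p, c; split=> [k|x|]; first by rewrite pA.
    rewrite fE (bigD1 (p x)) //= big1 => [|k kp].
      by rewrite indicE mem_set // mulr1 addr0.
    rewrite indicE memNset ?mulr0 // => Ak.
    by move/eqP: kp; apply; apply: tA => //; exists x.
  by apply: eq_bigr => k _; rewrite pA.
(* [partition] requires nonempty cells, so only the attained values are kept and enumerated; the
   others have empty fibres and contribute 0 to the sum. *)
pose P := [set t | `[< p @^-1` [set t] !=set0 >]]%SET.
have pP x : p x \in P by rewrite inE; apply/asboolP; exists x.
pose r k := enum_val (k : 'I_#|P|).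
exists #|P|, (u \o r), (fun k => p @^-1` [set r k]).
have rP x : exists2 k, r k = p x & forall j, r j = p x -> j = k.
  exists (enum_rank_in (pP x) (p x)); first exact: enum_rankK_in.
  by move=> j jx; apply: enum_val_inj; rewrite enum_rankK_in.
split=> //.
- split.
  + by apply/seteqP; split=> // x _; have [k kx _] := rP x; exists k.
  + move=> i j _ _ [x [/= xi xj]]; have [k _ H] := rP x.
    by rewrite (H i) // (H j).
  + by move=> i _; have := enum_valP i; rewrite inE => /asboolP.
- move=> x; have [k kx H] := rP x.
  rewrite (bigD1 k) //= big1 => [|j jk].
    by rewrite indicE mem_set //= mulr1 addr0 fE kx.
  by rewrite indicE memNset ?mulr0 //= => /esym/H jE; rewrite jE eqxx in jk.
- rewrite /fsum (bigID (mem P)) /= [X in _ + X]big1 => [|t].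
    by rewrite addr0 big_enum_val.
  rewrite inE => /asboolP/set0P/negP; rewrite negbK => /eqP->.
  by rewrite cs_charge0 mulr0.
Qed.

Lemma simple_integralE T (p : X -> T) u f : field_map p ->
  (forall x, f x = u (p x)) -> simple_integral C f = fsum p u.
Proof.
move=> fp fE; rewrite /simple_integral; case: xgetP => [I _|/(_ (fsum p u))[]].
  move=> /simple_with_integralP[U [q [v [fq fE' ->]]]].
  apply/eqP; rewrite eq_le; apply/andP.
  by split; apply: fsum_le => // x; rewrite -fE -fE'.
by apply/simple_with_integralP; exists T, p, u.
Qed.

Lemma simple_funP f : simple_fun C f <->
  exists T (p : X -> T) u, field_map p /\ forall x, f x = u (p x).
Proof.
split=> [[I /simple_with_integralP[T [p [u []]]]]|[T [p [u [fp fE]]]]].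
  by exists T, p, u.
by exists (fsum p u); apply/simple_with_integralP; exists T, p, u.
Qed.

Lemma simple_fun_common f g : simple_fun C f -> simple_fun C g ->
  exists T (p : X -> T) u v,
    [/\ field_map p, forall x, f x = u (p x) & forall x, g x = v (p x)].
Proof.
move=> /simple_funP[T [p [u [fp fE]]]] /simple_funP[U [q [v [fq gE]]]].
exists (T * U)%type, (fun x => (p x, q x)), (u \o fst), (v \o snd).
by split=> //; exact: field_map_pair.
Qed.

Lemma simple_fun2 (h : R -> R -> R) f g : simple_fun C f -> simple_fun C g ->
  simple_fun C (fun x => h (f x) (g x)).
Proof.
move=> sf /(simple_fun_common sf)[T [p [u [v [fp fE gE]]]]].
apply/simple_funP; exists T, p, (fun t => h (u t) (v t)).
by split=> // x; rewrite fE gE.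
Qed.

Lemma simple_fun1 (h : R -> R) f : simple_fun C f ->
  simple_fun C (fun x => h (f x)).
Proof. by move=> sf; exact: (simple_fun2 (fun a _ => h a) sf sf). Qed.

Lemma simple_fun_field (P : set R) f : simple_fun C f -> field [set x | P (f x)].
Proof.
move=> /simple_funP[T [p [u [fp fE]]]].
have -> : [set x | P (f x)] = p @^-1` [set t | P (u t)].
  by apply/seteqP; split=> x /=; rewrite fE.
exact: field_preimage.
Qed.

Lemma simple_fun_bounded f : simple_fun C f ->
  exists2 M, 0 < M & forall x, `|f x| <= M.
Proof.
move=> /simple_funP[T [p [u [fp fE]]]]; exists (1 + \sum_t `|u t|).
  by rewrite ltr_wpDr // sumr_ge0.
move=> x; rewrite fE (bigD1 (p x)) //= addrCA lerDl.
by rewrite addr_ge0 // sumr_ge0.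
Qed.

Lemma simple_integral_le f g : simple_fun C f -> simple_fun C g ->
  (forall x, f x <= g x) -> simple_integral C f <= simple_integral C g.
Proof.
move=> sf /(simple_fun_common sf)[T [p [u [v [fp fE gE]]]]] fg.
rewrite (simple_integralE fp fE) (simple_integralE fp gE).
by apply: fsum_le => // x; rewrite -fE -gE.
Qed.

Lemma simple_integralD f g : simple_fun C f -> simple_fun C g ->
  simple_integral C (fun x => f x + g x) =
  simple_integral C f + simple_integral C g.
Proof.
move=> sf /(simple_fun_common sf)[T [p [u [v [fp fE gE]]]]].
rewrite (simple_integralE fp fE) (simple_integralE fp gE).
rewrite (@simple_integralE _ p (fun t => u t + v t)) //; last first.
  by move=> x; rewrite fE gE.
by rewrite -big_split; apply: eq_bigr => t _; rewrite mulrDl.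
Qed.

Lemma simple_fun_integral_indic (c : R) A : field A ->
  simple_fun C (fun x => c * \1_A x) /\
  simple_integral C (fun x => c * \1_A x) = c * mu A.
Proof.
move=> fA; pose u (b : bool) : R := c * b%:R.
have fp : field_map (fun x => x \in A).
  move=> b; have -> : (fun x => x \in A) @^-1` [set b] = if b then A else ~` A.
    case: b; apply/seteqP; split=> x /=.
    - by move/set_mem.
    - exact: mem_set.
    - by move=> /negbT/negP H Ax; apply: H; exact: mem_set.
    - exact: memNset.
  by case: b => //; exact: cs_fieldC.
have fE x : c * \1_A x = u (x \in A) by rewrite indicE.
split; first by apply/simple_funP; exists bool, (fun x => x \in A), u.
rewrite (simple_integralE fp fE) /fsum big_bool /u.
rewrite mulr0n mulr1n mulr0 mul0r mulr1 [LHS]addr0.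
by congr (c * mu _); apply/seteqP; split=> x /=; [move/set_mem|exact: mem_set].
Qed.

Lemma simple_integral_ge0 f : simple_fun C f -> (forall x, 0 <= f x) ->
  0 <= simple_integral C f.
Proof.
move=> sf f0; have [s0 i0] := simple_fun_integral_indic 0 (cs_field0 C).
rewrite -[leLHS](mul0r (mu set0)) -i0.
by apply: simple_integral_le => // x; rewrite mul0r.
Qed.

Lemma simple_markov f e : simple_fun C f ->
  e * mu [set x | e <= `|f x|] <= simple_integral C (fun x => `|f x|).
Proof.
move=> sf; have sn := simple_fun1 Num.norm sf.
have fE := simple_fun_field (fun y => e <= y) sn.
have [s1 <-] := simple_fun_integral_indic e fE.
apply: simple_integral_le => // x; rewrite indicE.
by case: (boolP (_ \in _)) => [/set_mem|_]; rewrite ?mulr1 ?mulr0.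
Qed.

Lemma simple_normD f g h : simple_fun C f -> simple_fun C g -> simple_fun C h ->
  (forall x, `|f x| <= `|g x| + `|h x|) ->
  simple_integral C (fun x => `|f x|) <=
  simple_integral C (fun x => `|g x|) + simple_integral C (fun x => `|h x|).
Proof.
move=> sf sg sh fgh; rewrite -simple_integralD; try exact: simple_fun1.
apply: simple_integral_le => //; first exact: simple_fun1.
exact: (simple_fun2 (fun a b => `|a| + `|b|)).
Qed.

End simple_functions.

(** * Convergence of real sequences in terms of thresholds *)

Section convergence_criteria.
Context {R : realType}.

Lemma cvg0_seqP (u : nat -> R) : (forall n, 0 <= u n) ->
  (u n @[n --> \oo] --> 0) <->
  (forall e, 0 < e -> exists N, forall n, (N <= n)%N -> u n < e).
Proof.
move=> u0; split=> [/cvgr0Pnorm_lt H e /H[N _ HN]|H].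
  by exists N => n /HN; rewrite /= ger0_norm.
apply/cvgr0Pnorm_lt => e /H[N HN]; exists N => // n /= /HN.
by rewrite ger0_norm.
Qed.

Lemma cvg0_seq2P (u : nat -> nat -> R) : (forall n m, 0 <= u n m) ->
  (u p.1 p.2 @[p --> filter_prod \oo \oo] --> 0) <->
  (forall e, 0 < e -> exists N, forall n m, (N <= n)%N -> (N <= m)%N -> u n m < e).
Proof.
move=> u0; split=> [/cvgr0Pnorm_lt H e /H[[P Q] [/= [N _ NP] [M _ MQ]] PQ]|H].
  exists (maxn N M) => n m; rewrite !geq_max => /andP[Nn _] /andP[_ Mm].
  rewrite -(ger0_norm (u0 n m)); apply: (PQ (n, m)).
  by split; [exact: NP|exact: MQ].
apply/cvgr0Pnorm_lt => e /H[N HN].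
exists ([set n | (N <= n)%N], [set n | (N <= n)%N]); first by split; exists N.
by move=> [n m] [/= Nn Nm]; rewrite ger0_norm // HN.
Qed.

Lemma cauchy_seq_cvg (u : nat -> R) :
  (forall e, 0 < e -> exists N, forall n m, (N <= n)%N -> (N <= m)%N ->
    `|u n - u m| < e) -> exists l : R, u @ \oo --> l.
Proof.
move=> H; suff : cvgn u by move=> cu; exists (limn u).
apply/cauchy_cvgP/cauchy_exP => e /H[N HN]; exists (u N).
by exists N => // n /= Nn; apply: HN.
Qed.

End convergence_criteria.

(** * Outer charge and hazy convergence *)

Section outer.
Context {R : realType} {X : Type} (C : charge_space R X).
Implicit Types (A B : set X) (f g : X -> R) (s t : nat -> X -> R).

Local Notation mu := (cs_charge C).
Local Notation field := (cs_field C).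

Let outer_n0 A : [set mu B | B in [set B | field B /\ A `<=` B]] !=set0.
Proof. by exists (mu setT), setT => //; split=> //; exact: cs_fieldT. Qed.

Let outer_lb A : lbound [set mu B | B in [set B | field B /\ A `<=` B]] 0.
Proof. by move=> _ [B [fB _] <-]; exact: cs_charge_ge0. Qed.

Lemma outer_charge_le A B : field B -> A `<=` B -> outer_charge C A <= mu B.
Proof. by move=> fB AB; apply: ge_inf; [exists 0; exact: outer_lb|exists B]. Qed.

Lemma outer_charge_ge0 A : 0 <= outer_charge C A.
Proof. by apply: lb_le_inf; [exact: outer_n0|exact: outer_lb]. Qed.

Lemma outer_charge_lt A e : outer_charge C A < e ->
  exists B, [/\ field B, A `<=` B & mu B < e].
Proof.
by move=> /(inf_lt (outer_n0 A))[_ [B [fB AB] <-] Be]; exists B.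
Qed.

Lemma outer_chargeE A : field A -> outer_charge C A = mu A.
Proof.
move=> fA; apply/eqP; rewrite eq_le outer_charge_le //=.
apply: lb_le_inf; first exact: outer_n0.
by move=> _ [B [fB AB] <-]; exact: cs_charge_le.
Qed.

(** An outer charge below [e] is witnessed by a covering set of the field with charge below [e], so
    hazy convergence can be handled with exceptional sets from the field. *)
Lemma hazy_cvgP s f : hazy_cvg C s f <->
  forall e, 0 < e -> exists N, forall n, (N <= n)%N -> exists B,
    [/\ field B, mu B < e & forall x, ~ B x -> `|s n x - f x| <= e].
Proof.
split=> H e e0.
  have /cvg0_seqP-/(_ _ e e0)[|N HN] := H e e0.
    by move=> n; exact: outer_charge_ge0.
  exists N => n /HN/outer_charge_lt[B [fB sB Be]]; exists B; split=> // x Bx.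
  by rewrite leNgt; apply/negP => /sB.
apply/cvg0_seqP => [n|d d0]; first exact: outer_charge_ge0.
(* One number serves as the distance tolerance, bounded by [e], and as the charge bound, bounded by
   [d]. *)
have ed0 : 0 < Num.min e d by rewrite lt_min e0.
have [N HN] := H _ ed0; exists N => n /HN[B [fB Bd sB]].
apply: (@le_lt_trans _ _ (mu B)).
  apply: outer_charge_le => // x /= ex; apply: contrapT => /sB.
  by rewrite le_min leNgt ex.
by apply: lt_le_trans Bd _; rewrite ge_min lexx orbT.
Qed.

Lemma hazy_cvg_le2 s t r f g h : hazy_cvg C s f -> hazy_cvg C t g ->
  (forall n x, `|r n x - h x| <= `|s n x - f x| + `|t n x - g x|) ->
  hazy_cvg C r h.
Proof.
move=> /hazy_cvgP Hs /hazy_cvgP Ht H; apply/hazy_cvgP => e e0.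
have e20 : 0 < e / 2 by rewrite divr_gt0.
have [N HN] := Hs _ e20; have [M HM] := Ht _ e20.
exists (maxn N M) => n; rewrite geq_max => /andP[/HN[A [fA Ae sA]] /HM[B [fB Be sB]]].
exists (A `|` B); split; first exact: cs_fieldU.
  by apply: le_lt_trans (chargeU_le fA fB) _; lra.
move=> x /not_orP[/sA ? /sB ?]; have := H n x; lra.
Qed.

End outer.

(** * Determining sequences and well-definedness of the norm *)

Section L1norm.
Context {R : realType} {X : Type} (C : charge_space R X).
Implicit Types (A B : set X) (f g : X -> R) (s t : nat -> X -> R).

Local Notation mu := (cs_charge C).
Local Notation field := (cs_field C).
Local Notation nrm f := (simple_integral C (fun x => `|f x|)).

Definition simple_cauchy s := forall e, 0 < e ->
  exists N, forall n m, (N <= n)%N -> (N <= m)%N -> nrm (s n \- s m) < e.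

Lemma nrm_ge0 f : simple_fun C f -> 0 <= nrm f.
Proof. by move=> sf; apply: simple_integral_ge0 => //; exact: simple_fun1. Qed.

Lemma simple_funB f g : simple_fun C f -> simple_fun C g -> simple_fun C (f \- g).
Proof. exact: (simple_fun2 (fun a b => a - b)). Qed.

Lemma determiningP s f : determining C s f <->
  [/\ forall n, simple_fun C (s n), hazy_cvg C s f & simple_cauchy s].
Proof.
split=> -[ss hs cs]; split=> //.
  by apply/(cvg0_seq2P (u := fun n m => nrm (s n \- s m))) => // n m;
     exact/nrm_ge0/simple_funB.
by apply/(cvg0_seq2P (u := fun n m => nrm (s n \- s m))) => // n m;
   exact/nrm_ge0/simple_funB.
Qed.

(** Fix [s N] with [N] late, bounded by [M]. Outside a small set [B], [s n] is at most [d] in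
    absolute value; on [B] it is at most [|s n - s N| + M]. The three contributions
    [nrm (s n \- s N)], [M * mu B] and [d * mu setT] are each at most [e / 4]. *)
Lemma simple_null_cvg s : (forall n, simple_fun C (s n)) -> simple_cauchy s ->
  hazy_cvg C s (fun=> 0) -> forall e, 0 < e ->
  exists N, forall n, (N <= n)%N -> nrm (s n) < e.
Proof.
move=> ss cs /hazy_cvgP hs e e0.
have e40 : 0 < e / 4 by rewrite divr_gt0.
have [N HN] := cs _ e40.
have [M M0 sNM] := simple_fun_bounded (ss N).
have T0 : 0 <= mu setT by apply: cs_charge_ge0; exact: cs_fieldT.
(* The summand 1 keeps the denominator positive when the whole space has charge 0. *)
pose d := e / 4 / (1 + mu setT).
have d0 : 0 < d by rewrite divr_gt0 // ltr_wpDr.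
have dT : d * mu setT <= e / 4.
  by rewrite /d mulrAC ler_pdivrMr ?ltr_wpDr // ler_pM2l // lerDr.
have eM0 : 0 < e / 4 / M by rewrite divr_gt0.
have dM0 : 0 < Num.min d (e / 4 / M) by rewrite lt_min d0.
have [N' HN'] := hs _ dM0.
exists (maxn N N') => n; rewrite geq_max => /andP[Nn /HN'[B [fB Bd sB]]].
have {Bd} BM : M * mu B <= e / 4.
  rewrite mulrC -ler_pdivlMr //; apply: ltW (lt_le_trans Bd _).
  by rewrite ge_min lexx orbT.
have [s1 i1] := simple_fun_integral_indic M fB.
have [s2 i2] := simple_fun_integral_indic d (cs_fieldT C).
have s12 := simple_fun2 +%R s1 s2.
have s3 := simple_fun1 Num.norm (simple_funB (ss n) (ss N)).
have : nrm (s n) <= simple_integral C (fun x => `|(s n \- s N) x| +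
    (M * \1_B x + d * \1_setT x)).
  apply: simple_integral_le => [||x]; first exact: simple_fun1.
    exact: (simple_fun2 +%R).
  rewrite !indicE (in_setT x) mulr1 /=.
  case: (boolP (x \in B)) => [_|/negP xB].
    have := sNM x; have := ler_normD (s n x - s N x) (s N x).
    by rewrite subrK mulr1; lra.
  have : ~ B x by move=> ?; apply: xB; exact: mem_set.
  move=> /sB; rewrite subr0 mulr0 add0r le_min => /andP[+ _].
  have := normr_ge0 (s n x - s N x); lra.
rewrite simple_integralD // simple_integralD // i1 i2.
have := HN n N Nn (leqnn _); lra.
Qed.

(** The difference [s n \- t n] is Cauchy and tends hazily to 0, so [simple_null_cvg] applies. This
    is why the integral does not depend on the determining sequence. *)
Lemma determining_unique s t f : determining C s f -> determining C t f ->
  forall e, 0 < e -> exists N, forall n, (N <= n)%N -> nrm (s n \- t n) < e.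
Proof.
move=> /determiningP[ss hs cs] /determiningP[st ht ct].
apply: simple_null_cvg.
- by move=> n; exact: simple_funB.
- move=> e e0; have e20 : 0 < e / 2 by rewrite divr_gt0.
  have [N HN] := cs _ e20; have [M HM] := ct _ e20.
  exists (maxn N M) => n m; rewrite !geq_max => /andP[Nn Mn] /andP[Nm Mm].
  have := HN _ _ Nn Nm; have := HM _ _ Mn Mm.
  have := @simple_normD _ _ C ((s n \- t n) \- (s m \- t m)) (s n \- s m) (t n \- t m).
  move=> /(_ _ _ _ _)/=; set a := simple_integral _ _; set b := simple_integral _ _.
  set c := simple_integral _ _ => H.
  suff : a <= b + c by lra.
  apply: H; [|exact: simple_funB|exact: simple_funB|move=> x].
    by apply: simple_funB; exact: simple_funB.
  by rewrite [X in `|X|](_ : _ = (s n x - s m x) - (t n x - t m x)) ?ler_normB//; lra.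
- apply: hazy_cvg_le2 hs ht _ => n x.
  by rewrite [X in `|X|](_ : _ = (s n x - f x) - (t n x - f x)) ?ler_normB//=; lra.
Qed.

(** Handles absolute values and differences at once: a pointwise Lipschitz operation preserves both
    hazy convergence and the Cauchy property. *)
Lemma determining_le2 s t r f g h : determining C s f -> determining C t g ->
  (forall n, simple_fun C (r n)) ->
  (forall n x, `|r n x - h x| <= `|s n x - f x| + `|t n x - g x|) ->
  (forall n m x, `|r n x - r m x| <= `|s n x - s m x| + `|t n x - t m x|) ->
  determining C r h.
Proof.
move=> /determiningP[ss hs cs] /determiningP[st ht ct] sr h1 h2.
apply/determiningP; split=> //; first exact: hazy_cvg_le2 hs ht h1.
move=> e e0; have e20 : 0 < e / 2 by rewrite divr_gt0.
have [N HN] := cs _ e20; have [M HM] := ct _ e20.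
exists (maxn N M) => n m; rewrite !geq_max => /andP[Nn Mn] /andP[Nm Mm].
apply: le_lt_trans (simple_normD _ _ _ (h2 n m)) _; try exact: simple_funB.
by have := HN _ _ Nn Nm; have := HM _ _ Mn Mm; rewrite /=; lra.
Qed.

Lemma determining_simple f : simple_fun C f -> determining C (fun=> f) f.
Proof.
move=> sf; apply/determiningP; split=> //.
  apply/hazy_cvgP => e e0; exists 0%N => n _; exists set0.
  split; first exact: cs_field0.
    by rewrite cs_charge0.
  by move=> x _; rewrite subrr normr0 ltW.
move=> e e0; exists 0%N => n m _ _.
have [s0 i0] := simple_fun_integral_indic 0 (cs_field0 C).
rewrite (_ : (fun x => _) = (fun x => 0 * \1_set0 x)) ?i0 ?mul0r //.
by apply/funext => x /=; rewrite subrr normr0 mul0r.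
Qed.

Lemma simple_integral_dist f g : simple_fun C f -> simple_fun C g ->
  `|simple_integral C f - simple_integral C g| <= nrm (f \- g).
Proof.
have H u v : simple_fun C u -> simple_fun C v ->
    simple_integral C u <= nrm (u \- v) + simple_integral C v.
  move=> su sv; have sn := simple_fun1 Num.norm (simple_funB su sv).
  rewrite -simple_integralD //; apply: simple_integral_le => //.
    exact: (simple_fun2 +%R).
  by move=> x /=; rewrite -lerBlDr ler_norm.
move=> sf sg; rewrite ler_norml; have := H _ _ sf sg; have := H _ _ sg sf.
under eq_fun do rewrite /= distrC.
by move=> h1 h2; apply/andP; split; rewrite /=; lra.
Qed.

(** The functions [|s n|] determine [|f|], and their integrals form a Cauchy sequence of reals.
    Every determining sequence of [f] thus computes its norm. *)
Lemma L1norm_cvg s f : determining C s f -> nrm (s n) @[n --> \oo] --> L1norm C f.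
Proof.
move=> ds; have [ss hs cs] := (determiningP _ _).1 ds.
have ssn n : simple_fun C (fun x => `|s n x|) by exact: simple_fun1.
have dsn : determining C (fun n x => `|s n x|) (fun x => `|f x|).
  apply: (determining_le2 ds ds ssn) => [n|n m] x;
    by rewrite (le_trans (ler_dist_dist _ _)) // lerDl.
have [l sl] : exists l : R, nrm (s n) @[n --> \oo] --> l.
  apply: (@cauchy_seq_cvg _ (fun n => nrm (s n))) => e /cs[N HN]; exists N => n m Nn Nm.
  apply: le_lt_trans (HN n m Nn Nm).
  apply: le_trans (simple_integral_dist (ssn n) (ssn m)) _.
  apply: simple_integral_le => [||x] /=; last exact: ler_dist_dist.
    exact/simple_fun1/simple_funB.
  exact/simple_fun1/simple_funB.
(* [xget] returns a limit [I] along an unknown determining sequence [t] of [|f|], to be compared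
   with [|s n|]. The default value is excluded because [l] is a limit. *)
rewrite /L1norm /charge_integral; case: xgetP => [I _ [t dt tI]|/(_ l)[]]; last first.
  by exists (fun n x => `|s n x|).
have [st _ _] := (determiningP _ _).1 dt.
have h0 : (nrm (s n) - simple_integral C (t n)) @[n --> \oo] --> (0 : R).
  apply/cvgr0Pnorm_lt => e e0.
  have [N HN] := determining_unique dsn dt e0.
  exists N => // n /HN; apply: le_lt_trans.
  by apply: simple_integral_dist.
rewrite -[I]addr0 (_ : (fun n => nrm (s n)) = (fun n =>
  simple_integral C (t n) + (nrm (s n) - simple_integral C (t n)))).
  exact: cvgD tI h0.
by apply/funext => n; rewrite addrC subrK.
Qed.

End L1norm.

(** * Triangle inequality, density of simple functions and a Markov inequality in [L1] *)

Section L1norm_theory.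
Context {R : realType} {X : Type} (C : charge_space R X).
Implicit Types (A B : set X) (f g h : X -> R) (s t : nat -> X -> R).

Local Notation mu := (cs_charge C).
Local Notation field := (cs_field C).
Local Notation nrm f := (simple_integral C (fun x => `|f x|)).

Lemma L1norm_simple f : simple_fun C f -> L1norm C f = nrm f.
Proof.
move=> /determining_simple/L1norm_cvg H.
by apply: (cvg_unique _ H) => //; exact: cvg_cst.
Qed.

Lemma determiningB s t f g : determining C s f -> determining C t g ->
  determining C (fun n => s n \- t n) (f \- g).
Proof.
move=> ds dt; have [ss _ _] := (determiningP _ _ _).1 ds.
have [st _ _] := (determiningP _ _ _).1 dt.
have H (a b c d : R) : `|a - b - (c - d)| <= `|a - c| + `|b - d|.
  by rewrite (_ : a - b - (c - d) = (a - c) - (b - d)) ?ler_normB//; lra.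
apply: (determining_le2 ds dt) => [n|n x|n m x]; first exact: simple_funB.
  exact: H.
exact: H.
Qed.

Lemma L1B f g : L1 C f -> L1 C g -> L1 C (f \- g).
Proof. by move=> [s ds] [t dt]; exists (fun n => s n \- t n); exact: determiningB. Qed.

Lemma L1_simple f : simple_fun C f -> L1 C f.
Proof. by move=> sf; exists (fun=> f); exact: determining_simple. Qed.

Lemma L1norm_ge s f e : determining C s f ->
  (exists N, forall n, (N <= n)%N -> e <= nrm (s n)) -> e <= L1norm C f.
Proof.
move=> ds [N HN]; have sf := L1norm_cvg ds; rewrite -(cvg_lim _ sf) //.
by apply: limr_ge; [apply/cvg_ex; eexists; exact: sf|exists N].
Qed.

Lemma L1norm_le s f e : determining C s f ->
  (exists N, forall n, (N <= n)%N -> nrm (s n) <= e) -> L1norm C f <= e.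
Proof.
move=> ds [N HN]; have sf := L1norm_cvg ds; rewrite -(cvg_lim _ sf) //.
by apply: limr_le; [apply/cvg_ex; eexists; exact: sf|exists N].
Qed.

Lemma L1norm_lt s f e : determining C s f -> L1norm C f < e ->
  exists N, forall n, (N <= n)%N -> nrm (s n) < e.
Proof.
by move=> /L1norm_cvg/cvgr_lt H /H[N _ HN]; exists N.
Qed.

Lemma L1norm_ge0 f : L1 C f -> 0 <= L1norm C f.
Proof.
move=> [s ds]; apply: (L1norm_ge ds); exists 0%N => n _; apply: nrm_ge0.
by have [ss _ _] := (determiningP _ _ _).1 ds.
Qed.

Lemma L1norm_distD g f h : L1 C f -> L1 C g -> L1 C h ->
  L1norm C (f \- h) <= L1norm C (f \- g) + L1norm C (g \- h).
Proof.
move=> [s ds] [t dt] [r dr]; apply/ler_addgt0Pr => e e0.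
have e20 : 0 < e / 2 by rewrite divr_gt0.
have [N HN] := L1norm_lt (determiningB ds dt) (ltr_pwDr e20 (lexx _)).
have [M HM] := L1norm_lt (determiningB dt dr) (ltr_pwDr e20 (lexx _)).
apply: (L1norm_le (determiningB ds dr)); exists (maxn N M) => n.
rewrite geq_max => /andP[/HN h1 /HM h2].
have [ss _ _] := (determiningP _ _ _).1 ds.
have [st _ _] := (determiningP _ _ _).1 dt.
have [sr _ _] := (determiningP _ _ _).1 dr.
apply: (le_trans (y := nrm (s n \- t n) + nrm (t n \- r n))).
  by apply: simple_normD => [|||x]; [exact: simple_funB..|exact: ler_distD].
by move: h1 h2; rewrite /=; lra.
Qed.

Lemma L1norm_distC f g : L1norm C (f \- g) = L1norm C (g \- f).
Proof.
by rewrite /L1norm; congr charge_integral; apply/funext => x; exact: distrC.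
Qed.

(** For fixed [n], the functions [s n \- s m] determine [s n \- f] as [m] grows, so the Cauchy bound
    passes to the limit. *)
Lemma L1norm_approx s f : determining C s f -> forall e, 0 < e ->
  exists N, forall n, (N <= n)%N -> L1norm C (s n \- f) < e.
Proof.
move=> ds e e0; have [ss _ cs] := (determiningP _ _ _).1 ds.
have e20 : 0 < e / 2 by rewrite divr_gt0.
have [N HN] := cs _ e20; exists N => n Nn.
apply: (@le_lt_trans _ _ (e / 2)); last lra.
apply: (L1norm_le (determiningB (determining_simple (ss n)) ds)).
by exists N => m Nm; apply: ltW; exact: HN.
Qed.

(** The set where [|f|] is large may lie outside the field. A simple [g] within [e] of [f] off a
    small set is used instead: Markov bounds the charge of the set where [|g|] is at least [e]. Each
    of the two steps costs one [e], whence [e *+ 2]. *)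
Lemma L1_markov f e : 0 < e -> L1 C f -> L1norm C f < e * e ->
  exists B, [/\ field B, mu B < e *+ 2 & forall x, ~ B x -> `|f x| <= e *+ 2].
Proof.
move=> e0 [s ds] /(L1norm_lt ds)[N HN].
have [ss /hazy_cvgP hs _] := (determiningP _ _ _).1 ds.
have [M HM] := hs _ e0.
have [B [fB Be sB]] := HM (maxn N M) (leq_maxr _ _).
have := HN (maxn N M) (leq_maxl _ _); move: sB; set g := s _ => sB gle.
have fA := simple_fun_field (fun y => e <= `|y|) (ss _ : simple_fun C g).
exists (B `|` [set x | e <= `|g x|]); split; first exact: cs_fieldU.
  have := simple_markov e (ss _ : simple_fun C g).
  move=> /le_lt_trans/(_ gle); rewrite ltr_pM2l // => Ae.
  by apply: le_lt_trans (chargeU_le fB fA) _; rewrite mulr2n ltrD.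
move=> x /not_orP[/sB + /= /negP]; rewrite -ltNge => h1 h2.
have := ler_normD (f x - g x) (g x); rewrite subrK distrC; lra.
Qed.

End L1norm_theory.

(** * Completeness of [L1] as a covering property of countable unions *)

Section approximable_unions.
Context {R : realType} {X : Type} (C : charge_space R X).
Implicit Types (A B : set X) (f g h : X -> R) (s t : nat -> X -> R).

Local Notation mu := (cs_charge C).
Local Notation field := (cs_field C).
Local Notation nrm f := (simple_integral C (fun x => `|f x|)).

(* The part of countable completeness and countable additivity modulo null sets
   that is equivalent to the completeness of [L1]. *)
Definition approximable_unions := forall A : nat -> set X, (forall n, field (A n)) ->
  forall e, 0 < e -> exists D m, [/\ field D, forall n, mu (A n `\` D) = 0
    & mu D <= mu (\big[setU/set0]_(i < m) A i) + e].

Lemma charge_union_sup (A : nat -> set X) e : (forall n, field (A n)) -> 0 < e ->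
  exists m, forall n,
    mu (\big[setU/set0]_(i < n) A i) < mu (\big[setU/set0]_(i < m) A i) + e.
Proof.
move=> fA e0; pose S := range (fun n => mu (\big[setU/set0]_(i < n) A i)).
have fB n : field (\big[setU/set0]_(i < n) A i) by exact: field_bigU.
have Ssup : has_sup S.
  split; first by exists (mu (\big[setU/set0]_(i < 0) A i)), 0%N.
  by exists (mu setT) => _ [n _ <-]; apply: cs_charge_le => //; exact: cs_fieldT.
have [_ [m _ <-] Hm] := sup_adherent e0 Ssup; exists m => n.
rewrite -ltrBlDr (le_lt_trans _ Hm) // lerB //.
by apply: ub_le_sup; [exact: Ssup.2|exists n].
Qed.

Lemma sub_bigU (A : nat -> set X) n m : (n <= m)%N ->
  \big[setU/set0]_(i < n) A i `<=` \big[setU/set0]_(i < m) A i.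
Proof.
move=> nm; rewrite -!bigcup_mkord => x [i /= ni Aix].
by exists i => //=; exact: leq_trans nm.
Qed.

(** The charges of the finite unions [B n] are increasing and bounded, so their indicators are
    Cauchy, with a limit [g]. With [D] the union of [B N] and [E], [|g|] is at most 1/4 on [A n]
    outside [D], whereas late indicators put [g] within 1/4 of 1 on [A n] off sets [E'] of
    arbitrarily small charge. Hence [A n] minus [D] lies in every such [E']. *)
Lemma L1_complete_approximable_unions : L1_complete C -> approximable_unions.
Proof.
move=> L1c A fA e e0; pose B n := \big[setU/set0]_(i < n) A i.
have fB n : field (B n) by exact: field_bigU.
pose f n x : R := 1 * \1_(B n) x.
have sf n : simple_fun C (f n) by exact: (simple_fun_integral_indic 1 (fB n)).1.
have fcauchy n m : (n <= m)%N -> nrm (f m \- f n) <= mu (B m) - mu (B n).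
  move=> nm; have BB := sub_bigU (A := A) nm.
  have fBB := cs_fieldD (fB m) (fB n).
  rewrite -(chargeD (fB m)) //; have [s1] := simple_fun_integral_indic 1 fBB.
  rewrite mul1r => <-; apply: simple_integral_le => //.
    exact/simple_fun1/simple_funB.
  move=> x; rewrite /f /= !mul1r !indicE.
  have [/set_mem Bmx|Bmx] := boolP (x \in B m); have [Bnx|Bnx] := boolP (x \in B n).
  - by rewrite subrr normr0.
  - by rewrite subr0 normr1 mem_set //; split=> //; by move/mem_set; exact/negP.
  - by move: Bmx; rewrite mem_set //; apply: BB; exact: set_mem.
  - by rewrite subrr normr0.
have [g Lg fg] : exists2 g, L1 C g & L1norm C (f n \- g) @[n --> \oo] --> (0 : R).
  apply: L1c => [n|]; first exact: L1_simple.
  apply/(cvg0_seq2P (u := fun n m => L1norm C (f n \- f m))) => [n m|d d0].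
    by apply/L1norm_ge0/L1_simple/simple_funB.
  have [N HN] := charge_union_sup fA d0.
  have H n m : (N <= n)%N -> (n <= m)%N -> L1norm C (f m \- f n) < d.
    move=> Nn nm; rewrite L1norm_simple; last exact: simple_funB.
    apply: le_lt_trans (fcauchy _ _ nm) _; rewrite ltrBlDl.
    apply: (lt_le_trans (HN m)); rewrite lerD2r.
    exact: cs_charge_le (fB N) (fB n) (sub_bigU Nn).
  exists N => n m Nn Nm; have [mn|/ltnW nm] := leqP m n; first exact: H.
  by rewrite L1norm_distC; exact: H.
have {}fg d : 0 < d -> exists N, forall n, (N <= n)%N -> exists E,
    [/\ field E, mu E < d *+ 2 & forall x, ~ E x -> `|f n x - g x| <= d *+ 2].
  move=> d0; have /cvg0_seqP-/(_ _ (d * d))[||N HN] := fg.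
  - by move=> n; apply/L1norm_ge0/L1B => //; exact: L1_simple.
  - exact: mulr_gt0.
  exists N => n /HN; apply: L1_markov => //.
  by apply: L1B => //; exact: L1_simple.
(* The first bound gives [mu E] at most [e]; the second keeps the neighbourhoods of the values 0 and
   1 apart. *)
pose d := Num.min (e / 2) (1 / 8).
have d0 : 0 < d by rewrite lt_min !divr_gt0.
have de : d *+ 2 <= e.
  by rewrite -mulr_natr -ler_pdivlMr // /d ge_min lexx.
have d4 : d *+ 2 <= 1 / 4.
  have : d <= 1 / 8 by rewrite /d ge_min lexx orbT.
  by rewrite mulr2n; lra.
have [N HN] := fg _ d0; have [E [fE Ed sE]] := HN _ (leqnn N).
have fD : field (B N `|` E) by exact: cs_fieldU.
exists (B N `|` E), N; split=> //; last first.
  by apply: le_trans (chargeU_le _ _) _ => //; rewrite lerD2l (le_trans (ltW Ed)).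
move=> n; have fZ := cs_fieldD (fA n) fD.
apply/eqP; rewrite eq_le cs_charge_ge0 // andbT; apply/ler_addgt0Pr => d1 d10.
rewrite add0r; pose d' := Num.min (d1 / 2) (1 / 8).
have d'0 : 0 < d' by rewrite lt_min !divr_gt0.
have d'e : d' *+ 2 <= d1.
  by rewrite -mulr_natr -ler_pdivlMr // /d' ge_min lexx.
have d'4 : d' *+ 2 <= 1 / 4.
  have : d' <= 1 / 8 by rewrite /d' ge_min lexx orbT.
  by rewrite mulr2n; lra.
have [M HM] := fg _ d'0.
(* The index must be at least [n.+1] because [B n] stops before [A n]. *)
have [E' [fE' Ed' sE']] := HM (maxn M n.+1) (leq_maxl _ _).
apply: le_trans (le_trans (ltW Ed') d'e); apply: cs_charge_le => // x [Anx].
move=> /not_orP[BNx Ex]; apply: contrapT => E'x.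
have xB : B (maxn M n.+1) x.
  apply: (sub_bigU (A := A) (leq_maxr M n.+1)); rewrite -bigcup_mkord.
  by exists n => /=.
have := sE _ Ex; have := sE' _ E'x.
rewrite /f !indicE (memNset BNx) (mem_set xB).
rewrite mulr0 sub0r normrN mulr1 => h1 h2.
have := ler_normD (1 - g x) (g x); rewrite subrK normr1; lra.
Qed.

(** Each [D k] misses only a null part of each later [A i], but infinitely many such parts need not
    have a small union. Setting the increment [dt i] to 0 on the null set [Z i] makes the geometric
    bound hold at every point off [D k], and changes each partial sum only on a null set. *)
Lemma approximable_unions_hazy_limit s : approximable_unions ->
  (forall n, simple_fun C (s n)) -> simple_cauchy C s -> exists f, hazy_cvg C s f.
Proof.
move=> AU ss cs; pose a k : R := 2^-1 ^+ k.
have a0 k : 0 < a k by rewrite exprn_gt0 // invr_gt0.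
have aS k : a k.+1 *+ 2 = a k.
  by rewrite /a exprS -mulrnAl -[_ *+ 2]mulr_natr mulVf ?mul1r.
(* With norm below [a k * a k], the Markov inequality bounds by [a k] the charge of the set where
   the increment is at least [a k]. *)
have /choice[N HN] k : exists N, forall n m, (N <= n)%N -> (N <= m)%N ->
    nrm (s n \- s m) < a k * a k.
  by apply: cs; rewrite mulr_gt0.
(* The running maximum makes the chosen indices nondecreasing. *)
pose M k := (\max_(i < k.+1) N i)%N.
have NM k : (N k <= M k)%N by exact: (leq_bigmax (ord_max : 'I_k.+1)).
have MS k : (M k <= M k.+1)%N by rewrite {2}/M big_ord_recr; exact: leq_maxl.
pose t k := s (M k); pose dt k := t k.+1 \- t k.
have sdt k : simple_fun C (dt k) by exact: simple_funB (ss _) (ss _).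
pose A k := [set x | a k <= `|dt k x|].
have fA k : field (A k) by exact: (simple_fun_field (fun y => a k <= `|y|)).
have muA k : mu (A k) <= a k.
  rewrite -(ler_pM2l (a0 k)); apply: le_trans (simple_markov _ (sdt k)) _.
  by apply/ltW/HN => //; exact: leq_trans (MS k).
have sumA k m : \sum_(i < m) a (k + i)%N = a k *+ 2 - a (k + m)%N *+ 2.
  elim: m => [|m IH]; first by rewrite big_ord0 addn0 subrr.
  by rewrite big_ord_recr /= IH addnS aS; lra.
(* The tail from [k] has total charge at most [a k *+ 2], and the cover is allowed an excess of
   [a k]. *)
have /choice[D HD] k : exists D, [/\ field D,
    forall i, (k <= i)%N -> mu (A i `\` D) = 0 & mu D <= a k *+ 3].
  have [//|D [m [fD nD leD]]] := AU (fun i => A (k + i)%N) _ _ (a0 k).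
  exists D; split=> // [i ki|]; first by rewrite -(subnKC ki).
  apply: le_trans leD _; rewrite mulrSr lerD2r.
  apply: le_trans (charge_bigU_le _ _) _ => //.
  apply: (@le_trans _ _ (\sum_(i < m) a (k + i)%N)); first exact: ler_sum.
  by rewrite sumA lerBlDr lerDl mulrn_wge0 // ltW.
have fD k : field (D k) by case: (HD k).
pose Z n := \big[setU/set0]_(k < n.+1) (A n `\` D k).
have fZ n : field (Z n) by apply: field_bigU => k _; exact: cs_fieldD.
have muZ n : mu (Z n) = 0.
  apply/eqP; rewrite eq_le cs_charge_ge0 // andbT.
  apply: le_trans (charge_bigU_le _ _) _ => [k _|]; first exact: cs_fieldD.
  by rewrite big1 // => k _; have [_ -> //] := HD k; rewrite -ltnS.
pose d i x := if `[< Z i x >] then 0 else dt i x.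
have dle k i x : (k <= i)%N -> ~ D k x -> `|d i x| <= a i.
  move=> ki Dx; rewrite /d; case: asboolP => [_|Zx]; first by rewrite normr0 ltW.
  rewrite leNgt; apply/negP => /ltW Ax; apply: Zx.
  by rewrite /Z -(bigcup_mkord _ (fun k => A i `\` D k)); exists k.
pose t' n x := t 0%N x + \sum_(i < n) d i x.
have t'le k n j x : (k <= n)%N -> ~ D k x ->
    `|t' (n + j)%N x - t' n x| <= a n *+ 2 - a (n + j)%N *+ 2.
  move=> kn Dx; elim: j => [|j IH]; first by rewrite addn0 !subrr normr0.
  rewrite addnS aS /t' big_ord_recr /= -/(t' _ _).
  have := dle k (n + j)%N x (leq_trans kn (leq_addr _ _)) Dx.
  have := ler_normD (t' (n + j)%N x - t' n x) (d (n + j)%N x).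
  rewrite [X in `|X| <= _ -> _](_ : _ =
    t 0%N x + (\sum_(i < n + j) d i x + d (n + j)%N x) -
      (t 0%N x + \sum_(i < n) d i x)); last by rewrite /t'; lra.
  by move: IH; rewrite !mulr2n; lra.
have t'le2 k n m x : (k <= n)%N -> (n <= m)%N -> ~ D k x ->
    `|t' m x - t' n x| <= a n *+ 2.
  move=> kn nm Dx; have := t'le k n (m - n)%N x kn Dx; rewrite subnKC //.
  by move/le_trans; apply; rewrite lerBlDr lerDl mulrn_wge0 // ltW.
have a_small e : 0 < e -> exists k, a k *+ 4 < e.
  move=> e0; have e40 : 0 < e / 4 by rewrite divr_gt0.
  have /cvgr0Pnorm_lt/(_ _ e40)[k _ Hk] : a @ \oo --> 0.
    by apply: cvg_expr; rewrite gtr0_norm ?invr_gt0 // invf_lt1 // ltr1n.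
  exists k; have := Hk k (leqnn k); rewrite /= gtr0_norm // ltr_pdivlMr //.
  by rewrite mulr_natr.
(* A point where [t'] diverges lies in every [D k], hence in every exceptional set used below, so
   the value of [limn] there does not matter. *)
pose f x := limn (t'^~ x).
have t'f k x : ~ D k x -> t' n x @[n --> \oo] --> f x.
  move=> Dx; suff [l tl] : exists l : R, t' n x @[n --> \oo] --> l.
    by apply/cvg_ex; exists l.
  apply: (@cauchy_seq_cvg _ (t'^~ x)) => e /a_small[j je].
  have H n : (maxn k j <= n)%N -> `|t' n x - t' (maxn k j) x| < e / 2.
    move=> mn; apply: le_lt_trans (t'le2 k _ _ _ (leq_maxl _ _) mn Dx) _.
    have aj : a (maxn k j) <= a j.
      by rewrite /a ler_wiXn2l ?leq_maxr // ?invr_ge0 // invf_le1 // ler1n.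
    by move: aj je; rewrite ltr_pdivlMr // mulr_natr -mulrnA; lra.
  exists (maxn k j) => n m /H h1 /H h2.
  have := ler_distD (t' (maxn k j) x) (t' n x) (t' m x).
  by have := distrC (t' m x) (t' (maxn k j) x); lra.
have t'fle k n x : (k <= n)%N -> ~ D k x -> `|t' n x - f x| <= a n *+ 2.
  move=> kn Dx; apply/ler_addgt0Pr => e e0.
  have /cvgrPdist_lt/(_ e e0)[m _ Hm] := t'f _ _ Dx.
  have /= h1 := Hm (maxn n m) (leq_maxr _ _).
  have h2 := t'le2 k n _ x kn (leq_maxl n m) Dx.
  have := ler_distD (t' (maxn n m) x) (t' n x) (f x).
  by rewrite distrC in h1; rewrite distrC in h2; lra.
have t't n x : ~ (\big[setU/set0]_(i < n) Z i) x -> t' n x = t n x.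
  elim: n => [_|n IH]; first by rewrite /t' big_ord0 addr0.
  rewrite big_ord_recr /= => /not_orP[/IH {}IH /asboolPn/negbTE Zx].
  by rewrite /t' big_ord_recr /= addrA [X in X + _]IH /d Zx /dt /= addrC subrK.
exists f; apply/hazy_cvgP => e /a_small[k ke]; exists (M k) => n Mn.
have sst := simple_funB (ss n) (ss (M k)).
have fE := simple_fun_field (fun y => a k <= `|y|) sst.
set E := [set x | _] in fE.
have fU : field (\big[setU/set0]_(i < k) Z i) by exact: field_bigU.
have muE : mu E <= a k.
  rewrite -(ler_pM2l (a0 k)); apply: le_trans (simple_markov _ sst) _.
  by apply/ltW/HN => //; exact: leq_trans Mn.
(* The charges are at most [a k *+ 3], 0 and [a k], in total less than [e]. Outside this set [s n]
   is within [a k] of [t k], which equals [t' k], itself within [a k *+ 2] of [f]. *)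
exists (D k `|` \big[setU/set0]_(i < k) Z i `|` E); split.
- by do 2!apply: cs_fieldU => //.
- apply: le_lt_trans (chargeU_le _ _) _ => //; first exact: cs_fieldU.
  apply: le_lt_trans ke; rewrite mulrSr lerD //.
  apply: le_trans (chargeU_le _ _) _ => //.
  have [_ _ Dk] := HD k; rewrite -[leRHS]addr0 lerD //.
  by apply: le_trans (charge_bigU_le _ _) _ => //; rewrite big1.
- move=> x /not_orP[/not_orP[Dx Zx] /= /negP]; rewrite -ltNge => Ex.
  have := t'fle k k x (leqnn k) Dx; rewrite t't // => h.
  have := ler_distD (t k x) (s n x) (f x).
  by move: h ke Ex; rewrite !mulr2n !mulrSr /t; have := a0 k; lra.
Qed.

(** Each [f n] is replaced by a simple function at distance less than [1 / (n + 1)]. These form a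
    Cauchy sequence, so they determine their hazy limit [g], and the triangle inequality carries the
    convergence back to [f]. *)
Lemma approximable_unions_L1_complete : approximable_unions -> L1_complete C.
Proof.
move=> AU f Lf /(cvg0_seq2P (u := fun n m => L1norm C (f n \- f m))) fc.
have {}fc := fc (fun n m => L1norm_ge0 (L1B (Lf n) (Lf m))).
have /choice[s Hs] n : exists u,
    simple_fun C u /\ L1norm C (u \- f n) < n.+1%:R^-1.
  have [u du] := Lf n.
  have [ss _ _] := (determiningP _ _ _).1 du.
  have n0 : 0 < n.+1%:R^-1 :> R by rewrite invr_gt0.
  by have [N HN] := L1norm_approx du n0; exists (u N); split=> //; exact: HN.
have ss n : simple_fun C (s n) by case: (Hs n).
have Ls n := L1_simple (ss n).
have small e : 0 < e -> exists N, forall n, (N <= n)%N -> L1norm C (s n \- f n) < e.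
  move=> e0; have [N _ HN] := near_infty_natSinv_lt (PosNum e0).
  by exists N => n /HN; apply: lt_trans; case: (Hs n).
have sc : simple_cauchy C s.
  move=> e e0; have e30 : 0 < e / 3 by rewrite divr_gt0.
  have [N HN] := small _ e30; have [M HM] := fc _ e30.
  exists (maxn N M) => n m; rewrite !geq_max => /andP[Nn Mn] /andP[Nm Mm].
  rewrite -L1norm_simple; last exact: simple_funB.
  have h1 := L1norm_distD (Ls n) (Lf n) (Ls m).
  have h2 := L1norm_distD (Lf n) (Lf m) (Ls m).
  have h3 := HN _ Nn; have h4 := HN _ Nm; have h5 := HM _ _ Mn Mm.
  by rewrite L1norm_distC in h4; lra.
have [g sg] := approximable_unions_hazy_limit AU ss sc.
have ds : determining C s g by apply/determiningP.
have Lg : L1 C g by exists s.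
exists g => //; apply/(cvg0_seqP (u := fun n => L1norm C (f n \- g))) => [n|e e0].
  exact/L1norm_ge0/L1B.
have e20 : 0 < e / 2 by rewrite divr_gt0.
have [N HN] := small _ e20; have [M HM] := L1norm_approx ds e20.
exists (maxn N M) => n; rewrite geq_max => /andP[/HN h1 /HM h2].
have := L1norm_distD (Lf n) (Ls n) Lg.
by rewrite L1norm_distC in h1; lra.
Qed.

End approximable_unions.
(** Stated for an arbitrary additive function because it serves both the charge on the field and its
    extension to the Peano-Jordan completion. *)
Lemma additive_bigsetU {R : realType} {X : Type} (G : set (set X)) (nu : set X -> R)
    (F : nat -> set X) n : G set0 -> setU_closed G -> nu set0 = 0 ->
  (forall A B, G A -> G B -> A `&` B = set0 -> nu (A `|` B) = nu A + nu B) ->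
  (forall k, G (F k)) -> trivIset [set: nat] F ->
  nu (\big[setU/set0]_(i < n) F i) = series (nu \o F) n.
Proof.
move=> G0 GU nu0 nuU GF tF; elim: n => [|n IH].
  by rewrite big_ord0 /series /= big_geq.
rewrite big_ord_recr /= seriesSr nuU ?IH //; first by elim/big_ind: _.
rewrite -bigcup_mkord -subset0 => x [[i /= ni Fix] Fnx].
by have ii := tF i n I I (ex_intro _ x (conj Fix Fnx)); rewrite ii ltnn in ni.
Qed.

(** * When the Peano-Jordan completion is a measure space *)

Section peano_jordan_theory.
Context {R : realType} {Y : Type} (C : charge_space R Y).
Implicit Types A B D : set Y.

Local Notation mu := (cs_charge C).
Local Notation field := (cs_field C).
Local Notation pj := (pj_field C).

Lemma pj_charge_ge A B : field B -> B `<=` A -> mu B <= pj_charge C A.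
Proof.
move=> fB BA; apply: lb_le_inf.
  by exists (mu setT), setT => //; split=> //; exact: cs_fieldT.
by move=> _ [D [fD AD] <-]; apply: cs_charge_le => //; exact: subset_trans BA AD.
Qed.

Lemma pj_field_sub A : field A -> pj A.
Proof.
move=> fA e e0; exists A, A; split=> //.
by rewrite setDv cs_charge0.
Qed.

Lemma pj_fieldC : setC_closed pj.
Proof.
move=> A pA e /pA[B [D [fB fD BA AD De]]]; exists (~` D), (~` B).
split; [exact: cs_fieldC|exact: cs_fieldC|exact: subsetC|exact: subsetC|].
by rewrite setDE setCK setIC -setDE.
Qed.

Lemma pj_fieldU : setU_closed pj.
Proof.
move=> A1 A2 p1 p2 e e0; have e20 : 0 < e / 2 by rewrite divr_gt0.
have [B1 [D1 [fB1 fD1 BA1 AD1 De1]]] := p1 _ e20.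
have [B2 [D2 [fB2 fD2 BA2 AD2 De2]]] := p2 _ e20.
exists (B1 `|` B2), (D1 `|` D2).
split; [exact: cs_fieldU|exact: cs_fieldU|exact: setUSS|exact: setUSS|].
have f1 := cs_fieldD fD1 fB1; have f2 := cs_fieldD fD2 fB2.
apply: (@le_lt_trans _ _ (mu ((D1 `\` B1) `|` (D2 `\` B2)))).
  apply: cs_charge_le; [|exact: cs_fieldU|].
    by apply: cs_fieldD; exact: cs_fieldU.
  by move=> x [[? | ?] /not_orP[? ?]]; [left|right].
by apply: le_lt_trans (chargeU_le f1 f2) _; lra.
Qed.

Lemma pj_charge_approx A e : pj A -> 0 < e -> exists B D,
  [/\ field B, field D, B `<=` A, A `<=` D & mu D < mu B + e].
Proof.
move=> pA /pA[B [D [fB fD BA AD De]]]; exists B, D; split=> //.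
by rewrite -ltrBlDl -chargeD //; exact: subset_trans AD.
Qed.

(** Both sides lie between [mu B1 + mu B2] and [mu D1 + mu D2], which differ by at most [e]. *)
Lemma pj_chargeU A B : pj A -> pj B -> A `&` B = set0 ->
  pj_charge C (A `|` B) = pj_charge C A + pj_charge C B.
Proof.
move=> pA pB AB0.
have H e : 0 < e ->
    `|pj_charge C (A `|` B) - (pj_charge C A + pj_charge C B)| <= e.
  move=> e0; have e20 : 0 < e / 2 by rewrite divr_gt0.
  have [B1 [D1 [fB1 fD1 BA1 AD1 De1]]] := pj_charge_approx pA e20.
  have [B2 [D2 [fB2 fD2 BA2 AD2 De2]]] := pj_charge_approx pB e20.
  have B12 : B1 `&` B2 = set0.
    by rewrite -subset0 -AB0; exact: setISS.
  have h1 : mu B1 + mu B2 <= pj_charge C (A `|` B).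
    rewrite -cs_chargeU //; apply: pj_charge_ge; first exact: cs_fieldU.
    exact: setUSS.
  (* [pj_charge] and [outer_charge] have the same body, so [outer_charge_le] applies. *)
  have h2 : pj_charge C (A `|` B) <= mu D1 + mu D2.
    apply: le_trans (chargeU_le fD1 fD2).
    by apply: outer_charge_le; [exact: cs_fieldU|exact: setUSS].
  have h3 := pj_charge_ge fB1 BA1; have h4 := pj_charge_ge fB2 BA2.
  have h5 : pj_charge C A <= mu D1 := outer_charge_le fD1 AD1.
  have h6 : pj_charge C B <= mu D2 := outer_charge_le fD2 AD2.
  by rewrite ler_distl; apply/andP; split; lra.
apply/eqP; rewrite -subr_eq0 -normr_le0; apply/ler_addgt0Pr => e e0.
by rewrite add0r; exact: H.
Qed.

Lemma pj_charge0 : pj_charge C set0 = 0.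
Proof. by rewrite [LHS](outer_chargeE (cs_field0 C)) cs_charge0. Qed.

(** The counterpart of [approximable_unions] with true inclusions instead of inclusions up to null
    sets. *)
Definition coverable_unions := forall A : nat -> set Y, (forall n, field (A n)) ->
  forall e, 0 < e -> exists D m, [/\ field D, forall n, A n `<=` D
    & mu D <= mu (\big[setU/set0]_(i < m) A i) + e].

(** Each [F n] is sandwiched between [B' n] and [D' n] with gap less than [a n], and [D] covers the
    [D' n]. That the inner set lies in a finite union gives countable additivity as well as closure
    under countable unions. *)
Lemma coverable_unions_pj (F : nat -> set Y) e : coverable_unions ->
  (forall n, pj (F n)) -> 0 < e -> exists m B D, [/\ field B, field D,
    B `<=` \big[setU/set0]_(i < m) F i, \bigcup_n F n `<=` D & mu (D `\` B) < e].
Proof.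
move=> CU pF e0; pose a k : R := e / 4 * 2^-1 ^+ k.
have a0 k : 0 < a k by rewrite mulr_gt0 ?divr_gt0 // exprn_gt0 // invr_gt0.
have suma m : \sum_(i < m) a i <= e / 2.
  suff -> : \sum_(i < m) a i = e / 2 - a m *+ 2.
    by rewrite lerBlDr lerDl mulrn_wge0 // ltW.
  elim: m => [|m IH]; first by rewrite big_ord0 /a expr0; lra.
  by rewrite big_ord_recr /= IH /a exprS; lra.
have /choice[P PF] n : exists P : set Y * set Y, [/\ field P.1, field P.2,
    P.1 `<=` F n, F n `<=` P.2 & mu (P.2 `\` P.1) < a n].
  by have [B [D H]] := pF n _ (a0 n); exists (B, D).
have [B' [D' {P}PF]] : exists B' D' : nat -> set Y, forall n, [/\ field (B' n),
    field (D' n), B' n `<=` F n, F n `<=` D' n & mu (D' n `\` B' n) < a n].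
  by exists (fst \o P), (snd \o P).
have fB' n : field (B' n) by case: (PF n).
have fD' n : field (D' n) by case: (PF n).
have fPD n : field (D' n `\` B' n) by exact: cs_fieldD.
have e40 : 0 < e / 4 by rewrite divr_gt0.
have [D [m [fD sD Dle]]] := CU _ fD' _ e40.
have fB : field (\big[setU/set0]_(i < m) B' i) by exact: field_bigU.
have fU : field (\big[setU/set0]_(i < m) D' i) by exact: field_bigU.
exists m, (\big[setU/set0]_(i < m) B' i), D; split=> //.
- rewrite -!bigcup_mkord; move=> x [i im Px].
  by exists i => //; have [_ _ H _ _] := PF i; exact: H.
- apply: bigcup_sub => n _; apply: subset_trans (sD n).
  by case: (PF n).
have fW : field (\big[setU/set0]_(i < m) (D' i `\` B' i)) by exact: field_bigU.
have DU : \big[setU/set0]_(i < m) D' i `<=` D.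
  by rewrite -bigcup_mkord; apply: bigcup_sub.
(* The gap splits into the part of [D] outside the finite union of the [D' i], at most [e / 4], and
   the individual gaps, at most [e / 2]. *)
have := cs_charge_le (cs_fieldD fD fB) (cs_fieldU (cs_fieldD fD fU) fW).
move=> /(_ _)/le_lt_trans; apply.
  move=> x [Dx]; rewrite -!bigcup_mkord.
  rewrite -(bigcup_mkord _ (fun i => D' i `\` B' i)) => Bx.
  have [[i im Pix]|Ux] := pselect ((\bigcup_(i < m) D' i) x); last by left.
  by right; exists i => //; split=> // ?; apply: Bx; exists i.
apply: le_lt_trans (chargeU_le (cs_fieldD fD fU) fW) _.
rewrite chargeD //.
have : mu (\big[setU/set0]_(i < m) (D' i `\` B' i)) <= e / 2.
  apply: le_trans (charge_bigU_le _ _) _ => //.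
  apply: le_trans (suma m); apply: ler_sum => i _; apply: ltW.
  by case: (PF i).
by move: e40 Dle; lra.
Qed.

Lemma coverable_unions_measure_space : coverable_unions ->
  is_measure_space pj (pj_charge C).
Proof.
move=> CU; split; first split.
- exact/pj_field_sub/cs_field0.
- by move=> A pA; rewrite setTD; exact: pj_fieldC.
- move=> F pF e e0; have [m [B [D [fB fD BF FD De]]]] := coverable_unions_pj CU pF e0.
  exists B, D; split=> //; apply: subset_trans BF _.
  by rewrite -bigcup_mkord; exact: bigcup_subset.
move=> F pF tF; apply/cvgrPdist_le => e e0.
have [m [B [D [fB fD BF FD De]]]] := coverable_unions_pj CU pF e0.
exists m => // n /= mn.
rewrite -(@additive_bigsetU _ _ pj); last exact: tF.
- have BFn : B `<=` \big[setU/set0]_(i < n) F i.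
    exact: subset_trans BF (sub_bigU mn).
  have FnU : \big[setU/set0]_(i < n) F i `<=` \bigcup_k F k.
    by rewrite -bigcup_mkord; exact: bigcup_subset.
  have h1 := pj_charge_ge fB BFn.
  have h2 : pj_charge C (\bigcup_k F k) <= mu D := outer_charge_le fD FD.
  have h3 := pj_charge_ge fB (subset_trans BFn FnU).
  have h4 : pj_charge C (\big[setU/set0]_(i < n) F i) <= mu D.
    by apply: outer_charge_le => //; exact: subset_trans FnU FD.
  have BD : B `<=` D by apply: subset_trans FD; exact: subset_trans FnU.
  by move: De; rewrite chargeD // ler_distl => De; apply/andP; split; lra.
- exact/pj_field_sub/cs_field0.
- exact: pj_fieldU.
- exact: pj_charge0.
- exact: pj_chargeU.
- exact: pF.
Qed.

Lemma seqDU_field (A : nat -> set Y) : (forall n, field (A n)) ->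
  forall n, field (seqDU A n).
Proof. by move=> fA n; apply: cs_fieldD => //; exact: field_bigU. Qed.

Lemma charge_series_seqDU (A : nat -> set Y) n : (forall k, field (A k)) ->
  series (mu \o seqDU A) n = mu (\big[setU/set0]_(i < n) A i).
Proof.
move=> fA; rewrite bigsetU_seqDU (@additive_bigsetU _ _ field) //.
- exact: cs_field0.
- exact: cs_fieldU.
- exact: cs_charge0.
- exact: cs_chargeU.
- exact: seqDU_field.
Qed.

(** After making the [A n] disjoint, countable additivity puts some finite union within [e / 2] of
    the charge of the whole union. That charge is an infimum over covers in the field, which yields
    [D] within another [e / 2]. *)
Lemma measure_space_coverable_unions :
  is_measure_space pj (pj_charge C) -> coverable_unions.
Proof.
move=> [[_ _ pjU] sa] A fA e e0.
have e20 : 0 < e / 2 by rewrite divr_gt0.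
have fS := seqDU_field fA.
have := sa _ (fun n => pj_field_sub (fS n)) (trivIset_seqDU A).
rewrite -seqDU_bigcup_eq => /cvgrPdist_lt/(_ _ e20)[m _ /(_ m (leqnn m))] /=.
have -> : series (pj_charge C \o seqDU A) m = mu (\big[setU/set0]_(i < m) A i).
  by rewrite -charge_series_seqDU //; apply: eq_bigr => i _; exact: outer_chargeE.
have : outer_charge C (\bigcup_n A n) < pj_charge C (\bigcup_n A n) + e / 2.
  by rewrite ltrDl.
move=> /outer_charge_lt[D [fD AD De]] h; exists D, m; split=> //.
  by move=> n; apply: subset_trans AD; exact: bigcup_sup.
by move: h De; rewrite ltr_distl => /andP[h1 h2]; lra.
Qed.

End peano_jordan_theory.

(** * Transport of the covering property along the representation *)

Section representation_transport.
Context {R : realType} {X Y : Type} (C : charge_space R X).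
Variable phi : representation (null_quot C) Y.

Local Notation mu := (cs_charge C).
Local Notation field := (cs_field C).
Local Notation CY := (rep_charge_space phi).

Lemma rep_setU a b : rep_set phi (fldU a b) = rep_set phi a `|` rep_set phi b.
Proof. by rewrite /rep_set -fclassU; exact: repU. Qed.

Lemma rep_setD a b :
  rep_set phi (fldI a (fldC b)) = rep_set phi a `\` rep_set phi b.
Proof.
by rewrite /rep_set -fclassI -fclassC [LHS]repI [X in _ `&` X]repC setDE.
Qed.

(** The null sets are exactly the members of the zero class, and [phi] is injective. This turns
    inclusion up to a null set into inclusion. *)
Lemma rep_set0P a : rep_set phi a = set0 <-> mu (val a) = 0.
Proof.
split=> [a0|a0].
  by rewrite -(rep_chargeE phi) a0 -[RHS](cs_charge0 CY).
rewrite -(rep0 phi); congr (phi _); apply/fclassP.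
by rewrite [val (fld0 C)]/= setY0; split=> //; exact: fldP.
Qed.

(** The union is given as any [b] with the right underlying set, which leaves the choice of the
    membership proof free. *)
Lemma rep_set_bigU (a : nat -> field) m b :
  val b = \big[setU/set0]_(i < m) val (a i) ->
  rep_set phi b = \big[setU/set0]_(i < m) rep_set phi (a i).
Proof.
elim: m b => [|m IH] b; first rewrite !big_ord0 => b0.
  by apply/rep_set0P; rewrite b0 cs_charge0.
rewrite !big_ord_recr /= => bE.
have fm : field (\big[setU/set0]_(i < m) val (a i)).
  by apply: field_bigU => i _; exact: fldP.
rewrite -(IH (fld_mk fm)) // -rep_setU; congr rep_set; exact: val_inj.
Qed.

Lemma approximable_coverable_unions : approximable_unions C <-> coverable_unions CY.
Proof.
split=> AU A fA e e0.
  have /choice[a Ha] n : exists a, rep_set phi a = A n by have [a _] := fA n; exists a.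
  have [//|D [m [fD nD Dle]]] := AU (fun n => val (a n)) _ _ e0.
    by move=> n; exact: fldP.
  have fm : field (\big[setU/set0]_(i < m) val (a i)).
    by apply: field_bigU => i _; exact: fldP.
  exists (rep_set phi (fld_mk fD)), m; split=> [|n|]; first by exists (fld_mk fD).
    by rewrite -setD_eq0 -Ha -rep_setD; apply/rep_set0P; exact: nD.
  under eq_bigr do rewrite -Ha.
  by rewrite -(@rep_set_bigU a _ (fld_mk fm)) //= !rep_chargeE.
have [|_ [m [[d _ <-] AD Dle]]] := AU (fun n => rep_set phi (fld_mk (fA n))) _ _ e0.
  by move=> n; exists (fld_mk (fA n)).
have fm : field (\big[setU/set0]_(i < m) A i) by exact: field_bigU.
exists (val d), m; split; first exact: fldP.
  move=> n; apply/(rep_set0P (fldI (fld_mk (fA n)) (fldC d))).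
  by rewrite rep_setD setD_eq0.
move: Dle; rewrite -(@rep_set_bigU (fun n => fld_mk (fA n)) _ (fld_mk fm)) //=.
by rewrite !rep_chargeE.
Qed.

End representation_transport.

(** * Countably complete quotients with countably additive charge *)

(** The [A n] are first made disjoint so that countable additivity applies to the supremum [s] of
    their classes. A representative of [s] contains each disjoint piece up to a null set, hence also
    each [A n], a finite union of pieces at most. *)
Lemma countably_additive_approximable_unions {R : realType} {X : Type}
    (C : charge_space R X) : countably_complete (null_quot C) ->
  countably_additive (nq_charge C) -> approximable_unions C.
Proof.
move=> cc [_ _ ca] A fA e e0; have fE := seqDU_field fA.
pose p n : null_quot C := fclass (fld_mk (fE n)).
have dp i j : i != j -> (p i `&` p j)%O = \bot%O.
  move=> ij; rewrite [LHS]fclassI; congr fclass; apply: val_inj => /=.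
  apply/eqP; move/eqP: ij; apply: contra_notT => /set0P.
  exact: (trivIset_seqDU A i j I I).
have [s sups] := cc (range p) (card_image_le _ _).
have := ca p dp s sups => /cvgrPdist_lt/(_ _ e0)[m _ /(_ m (leqnn m))] /=.
have -> : series (nq_charge C \o p) m = cs_charge C (\big[setU/set0]_(i < m) A i).
  by rewrite -charge_series_seqDU //; apply: eq_bigr => i _; exact: nq_chargeE.
have {sups} ps i : (p i <= s)%O by apply: sups.1; exists i.
have [d ds] : exists d, fclass d = s by exists (repr s); exact: reprK.
rewrite -{s}ds in ps *; rewrite nq_chargeE ltr_distl => /andP[_ /ltW h].
have fD := fldP d; have fED i := cs_fieldD (fE i) fD.
have ED i : cs_charge C (seqDU A i `\` val d) = 0.
  (* In the quotient, [p i <= s] says that the meet of [p i] and [s] is [p i]: the piece and its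
     intersection with [val d] differ by a null set. *)
  have := ps i; rewrite leEmeet => /eqP; rewrite [LHS]fclassI => /fclassP/= ni.
  apply: (null_ideal_sub (fED i) ni _).2 => x [Ex Dx]; right; split=> //.
  by case.
exists (val d), m; split=> // n; apply/eqP.
rewrite eq_le cs_charge_ge0 ?andbT; last exact: cs_fieldD.
apply: (@le_trans _ _ (cs_charge C (\big[setU/set0]_(i < n.+1) (seqDU A i `\` val d)))).
  apply: cs_charge_le; [exact: cs_fieldD|exact: field_bigU|move=> x [Anx Dx]].
  have : (\big[setU/set0]_(i < n.+1) A i) x by rewrite -bigcup_mkord; exists n => /=.
  rewrite bigsetU_seqDU -bigcup_mkord => -[i ? ?].
  by rewrite -(bigcup_mkord _ (fun i => seqDU A i `\` val d)); exists i.
by apply: le_trans (charge_bigU_le _ _) _ => //; rewrite big1.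
Qed.

Theorem theorem29 (R : realType) (X : Type) (C : charge_space R X)
    (Y : Type) (phi : representation (null_quot C) Y) :
  (L1_complete C <->
     is_measure_space (pj_field (rep_charge_space phi))
       (pj_charge (rep_charge_space phi))) /\
  (countably_complete (null_quot C) ->
     countably_additive (nq_charge C) ->
     L1_complete C).
Proof.
split; last first.
  move=> cc ca; apply: approximable_unions_L1_complete.
  exact: countably_additive_approximable_unions.
split=> [/L1_complete_approximable_unions/(approximable_coverable_unions phi)|].
  exact: coverable_unions_measure_space.
move=> /measure_space_coverable_unions/(approximable_coverable_unions phi).
exact: approximable_unions_L1_complete.
Qed.
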